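(* Let $G$ be a pulsar on $n$ vertices built from two supernovas, the first with $\alpha_1$ cycles and $\beta_1$ pendant paths and the second with $\alpha_2$ cycles and $\beta_2$ pendant paths. Then $$I(G)=T_{[n-\alpha_1-\alpha_2-2,\,n]}\cup T^1_{[n-\alpha_1-\alpha_2-\beta_1,\,n]}\cup T^1_{[n-\alpha_1-\alpha_2-\beta_2,\,n]}\cup T^2_{[n-\alpha_1-\alpha_2-\beta_1-\beta_2,\,n]}.$$
   Context: All graphs are finite, simple and undirected. For a graph $G$ on vertices $1,\dots,n$, $S(G)$ is the set of real symmetric $n\times n$ matrices $A=[a_{ij}]$ such that for $i\ne j$, $a_{ij}\neq 0$ if and only if $ij$ is an edge of $G$ (diagonal entries are arbitrary real numbers). $\pi(A)$ and $\nu(A)$ are the numbers of positive and negative eigenvalues of $A$, counted with multiplicity. The inertia set of $G$ is $I(G)=\{(\pi(A),\nu(A)) : A\in S(G)\}$. For integers $k\ge 0$ and $m,n$, $T^k_{[m,n]}$ is the set of pairs $(r,s)$ of integers with $r\ge k$, $s\ge k$ and $m\le r+s\le n$. We write $T_{[m,n]}$ for $T^0_{[m,n]}$. If two graphs $F,H$ have exactly one common vertex $v$, $F\bigoplus_v H$ is the graph on $|F|+|H|-1$ vertices obtained by identifying the two copies of $v$. A generalized star is a graph composed of $p\ge 1$ paths (each with at least two vertices) having one endpoint each identified at a common vertex, the center, and otherwise disjoint. A bouquet is a graph composed of $k\ge 1$ cycles (each of length at least 3) joined at a common vertex, the center, and otherwise disjoint. A supernova with $\alpha\ge 1$ cycles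 and $\beta\ge 1$ pendant paths and center $v$ is a graph $G_\beta\bigoplus_v B$, where $G_\beta$ is a generalized star with $\beta$ paths and center $v$ and $B$ is a bouquet of $\alpha$ cycles with center $v$. A pulsar is a graph $F\bigoplus_v C\bigoplus_u H$, where $F$ and $H$ are disjoint supernovas with centers $v$ and $u$ respectively, and $C$ is a cycle containing $v$ and $u$ as distinct vertices that are not adjacent in $C$. The connecting cycle $C$ is not counted among the cycles of either supernova. *)

(* Defs.v *)
From HB Require Import structures.
From mathcomp Require Import all_boot all_order all_algebra.
From mathcomp Require Import polyrcf.
From mathcomp Require Import classical_sets reals.

Set Implicit Arguments.
Unset Strict Implicit.
Unset Printing Implicit Defensive.

Import Order.TTheory GRing.Theory Num.Theory.
Local Open Scope ring_scope.

(* A finite simple undirected graph whose vertex set is a subset of an ambient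
   finite type V.  Graphs over the same V may share vertices, so the graphs
   obtained by identifying vertices are unions of graphs whose vertex sets
   meet exactly in the identified vertices. *)
Record sgraph (V : finType) := SGraph {
  verts : {set V};
  edge : rel V;
  edge_sym : symmetric edge;
  edge_irr : irreflexive edge;
  edge_verts : forall x y, edge x y -> x \in verts
}.

Section Graphs.
Variable V : finType.
Implicit Types (F H G S B C P : sgraph V) (u v : V).

(* G is the sum of F and H at v. *)
Definition vertex_sum F v H G : Prop :=
  [/\ verts F :&: verts H = [set v],
      verts G = verts F :|: verts H &
      forall x y, edge G x y = edge F x y || edge H x y].

(* G is the union of the k graphs P i, which all contain v and are otherwise
   pairwise disjoint. *)
Definition joined_at k (P : 'I_k -> sgraph V) v G : Prop :=
  [/\ forall i, v \in verts (P i),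
      forall i j, i != j -> verts (P i) :&: verts (P j) = [set v],
      verts G = \bigcup_(i < k) verts (P i) &
      forall x y, edge G x y = [exists i, edge (P i) x y]].

(* P is a path with at least two vertices, one endpoint of which is v; its
   vertices are v :: s in path order. *)
Definition is_path_from v P : Prop :=
  exists s : seq V,
    [/\ (0 < size s)%N, uniq (v :: s), verts P = [set x in v :: s] &
        forall x y, edge P x y =
          [&& x \in v :: s, y \in v :: s &
              (index y (v :: s) == (index x (v :: s)).+1)
           || (index x (v :: s) == (index y (v :: s)).+1)]].

(* C is a cycle of length at least 3; its vertices are s in cyclic order. *)
Definition is_cycle C : Prop :=
  exists s : seq V,
    [/\ (3 <= size s)%N, uniq s, verts C = [set x in s] &
        forall x y, edge C x y =
          [&& x \in s, y \in s & (next s x == y) || (next s y == x)]].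

Definition is_generalized_star p v G : Prop :=
  (1 <= p)%N /\
  exists P : 'I_p -> sgraph V,
    (forall i, is_path_from v (P i)) /\ joined_at P v G.

Definition is_bouquet k v G : Prop :=
  (1 <= k)%N /\
  exists C : 'I_k -> sgraph V,
    (forall i, is_cycle (C i)) /\ joined_at C v G.

Definition is_supernova alpha beta v G : Prop :=
  exists S B,
    [/\ is_generalized_star beta v S, is_bouquet alpha v B &
        vertex_sum S v B G].

Definition is_pulsar alpha1 beta1 alpha2 beta2 G : Prop :=
  exists F C H v u,
    [/\ is_supernova alpha1 beta1 v F,
        is_supernova alpha2 beta2 u H &
        [disjoint verts F & verts H]] /\
    [/\ is_cycle C, v \in verts C, u \in verts C, v != u & ~~ edge C v u] /\
    exists FC, vertex_sum F v C FC /\ vertex_sum FC u H G.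

End Graphs.

Section Inertia.
Variable R : realType.

Definition pos_inertia n (A : 'M[R]_n) : nat :=
  (\sum_(x <- rootsR (char_poly A) | (0 < x)%R) mup x (char_poly A))%N.

Definition neg_inertia n (A : 'M[R]_n) : nat :=
  (\sum_(x <- rootsR (char_poly A) | (x < 0)%R) mup x (char_poly A))%N.

(* Meant for graphs with verts G = [set: 'I_n]. *)
Definition sym_matrices n (G : sgraph 'I_n) : set 'M[R]_n :=
  [set A | A^T = A /\ forall i j, i != j -> (A i j != 0) = edge G i j]%classic.

Definition inertia_set n (G : sgraph 'I_n) : set (int * int) :=
  [set ((pos_inertia A)%:Z, (neg_inertia A)%:Z) | A in sym_matrices G]%classic.

End Inertia.

Definition trapezoid (k m n : int) : set (int * int) :=
  [set rs | [/\ k <= rs.1, k <= rs.2 & m <= rs.1 + rs.2 <= n]]%classic.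

(* Main.v *)
Require Import Defs.
From HB Require Import structures.
From mathcomp Require Import classical_sets reals boolp.
From mathcomp Require Import all_boot all_order all_algebra.
From mathcomp Require Import polyrcf complex spectral sesquilinear zify ring.

Set Implicit Arguments.
Unset Strict Implicit.
Unset Printing Implicit Defensive.

Import Order.TTheory GRing.Theory Num.Theory.
Local Open Scope ring_scope.

(** Deleting the two centers v and u of a pulsar leaves disjoint paths, and
    the matrix of a path is tridiagonal with nonzero off-diagonal entries: a
    null vector vanishing at an end of the path is zero.  Everything is decided
    by whether some pendant path of v, or of u, carries a null vector.

    Constraints on the inertia.  If a pendant path of v is singular, its null
    vector w, extended by zero, satisfies w A = c e_v with c nonzero.  Then
    every null vector of A vanishes at v (dual_vertex_zero), and w spans an
    isotropic space on which A does not vanish, so that A has both a positive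
    and a negative eigenvalue; when both centers have such a pendant path, an
    isotropic plane gives two eigenvalues of each sign
    (isotropic_inertia_lb).  In each case zero forcing bounds the nullity: a
    null vector is determined by its values on a set which contains one vertex
    per cycle of a supernova, and
      - v and one neighbor of v on the connecting cycle, when neither center
        has a singular pendant path;
      - that neighbor and the starts of all pendant paths of v but one, when
        only v has one: the last pendant path is forced through row v once
        everything else vanishes;
      - one neighbor of v and one of u on the connecting cycle, and the starts
        of all pendant paths but one at each center, when both have one.
    This is pulsar_inertia_bound; each case is one of the four trapezoids.

    Realization.  A sum of terms +x^T x and -y^T y over linearly independent
    row vectors has as many positive (negative) eigenvalues as it has terms of
    that sign (inertia_signed_form), so each matrix is built by choosing
    vectors whose signs are free.  The consecutive differences e_i - e_j give
    a path; adding multiples of e_v to them closes a path of the cycle up at v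
    with no new vector (cycle_vectors); independence modulo the basis vector
    of a shared vertex is what survives gluing (realizes_union).  Keeping both
    centers in this way gives the first trapezoid.  Alternatively the whole
    row of v is produced by the hyperbolic pair e_v + z, e_v - z, where z is
    supported on the neighbors of v (realizes_hyperbolic): this costs one
    eigenvalue of each sign, but then the pieces of G - v can be realized
    independently, and a pendant path may do with one vector less than it has
    vertices.  Doing this at one center or at both gives the
    other trapezoids (pulsar_flexible0, pulsar_flexible1, pulsar_flexible2). *)

(** * Inertia and congruence *)

Section Diagonal.
Variable F : fieldType.

Lemma mxrank_sum_le (I : Type) (r : seq I) (P : pred I) m n
    (B : I -> 'M[F]_(m, n)) :
  (\rank (\sum_(i <- r | P i) B i)%R <= \sum_(i <- r | P i) \rank (B i))%N.
Proof.
elim/big_rec2: _ => [|i k M _ leMk]; first by rewrite mxrank0.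
by apply: leq_trans (mxrank_add _ _) _; rewrite leq_add2l.
Qed.

Lemma diag_mx_sum_supp n (d : 'rV[F]_n) :
  diag_mx d = \sum_(i | d 0 i != 0) d 0 i *: delta_mx i i.
Proof.
apply/matrixP=> i j; rewrite summxE mxE.
rewrite (eq_bigr (fun k => d 0 k * ((i == k) && (j == k))%:R)); last first.
  by move=> k _; rewrite !mxE.
have [<-|neq_ij] := eqVneq i j; last first.
  rewrite mulr0n big1 // => k _.
  have [/andP[/eqP ik /eqP jk]|_] := boolP (_ && _); last by rewrite mulr0.
  by rewrite ik jk eqxx in neq_ij.
have [di0|di0] := eqVneq (d 0 i) 0.
  rewrite di0 mul0rn big1 // => k dk0.
  by have [ik|_] := eqVneq i k; rewrite ?mulr0 // -ik di0 eqxx in dk0 *.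
rewrite (bigD1 i) //= !eqxx mulr1 big1 ?addr0 // => k /andP[_ nki].
by rewrite eq_sym (negPf nki) mulr0.
Qed.

Lemma mxrank_diag_le n (d : 'rV[F]_n) :
  (\rank (diag_mx d) <= #|[pred i | (d 0 i != 0)%R]|)%N.
Proof.
rewrite diag_mx_sum_supp -sum1_card; apply: leq_trans (mxrank_sum_le _ _ _) _.
apply: leq_sum => i _; apply: leq_trans (mxrank_scale _ _) _.
by rewrite mxrank_delta.
Qed.

Lemma mxrank_diag n (d : 'rV[F]_n) :
  \rank (diag_mx d) = #|[pred i | d 0 i != 0]|.
Proof.
apply/eqP; rewrite eqn_leq mxrank_diag_le /=.
pose z := \row_i (d 0 i == 0)%:R : 'rV[F]_n.
pose e := \row_i (d 0 i)^-1.
have split1 : 1%:M = diag_mx d *m diag_mx e + diag_mx z.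
  apply/matrixP=> i j; rewrite mulmx_diag !mxE.
  case: (i == j) => /=; rewrite ?mulr0n ?addr0 // !mulr1n.
  by have [->|di0] := eqVneq (d 0 i) 0; rewrite ?mul0r ?add0r // divff ?addr0.
have := mxrank1 F n; rewrite split1 => rk1.
have := mxrank_add (diag_mx d *m diag_mx e) (diag_mx z); rewrite rk1.
have := mxrankM_maxl (diag_mx d) (diag_mx e).
have := mxrank_diag_le z.
have cz : (#|[pred i | (z 0 i != 0)%R]| + #|[pred i | (d 0 i != 0)%R]| = n)%N.
  rewrite -[RHS](card_ord n) -(cardC [pred i | (d 0 i != 0)%R]) addnC.
  congr (_ + _)%N; apply: eq_card => i; rewrite !inE !mxE.
  by case: (d 0 i == 0); rewrite ?oner_neq0 ?eqxx.
lia.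
Qed.

Lemma char_poly_similar n (P D : 'M[F]_n) : P \in unitmx ->
  char_poly (invmx P *m D *m P) = char_poly D.
Proof.
move=> uP; rewrite /char_poly.
have -> : char_poly_mx (invmx P *m D *m P) =
  map_mx polyC (invmx P) *m char_poly_mx D *m map_mx polyC P.
  rewrite /char_poly_mx mulmxBr mulmxBl -!map_mxM; congr (_ - _).
  by rewrite mul_mx_scalar -scalemxAl -map_mxM mulVmx // map_mx1 scalemx1.
rewrite !det_mulmx mulrAC -det_mulmx -map_mxM mulVmx // map_mx1 det1 mul1r //.
Qed.

End Diagonal.

Section Spectral.
Variable R : realType.
Implicit Types n : nat.

Local Notation toC := (real_complex R).

Lemma conj_real_complex (x : R) : Num.conj (x%:C)%C = (x%:C)%C.
Proof. by apply/CrealP/complex_realP; exists x. Qed.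

Lemma real_spectral n (A : 'M[R]_n) : A^T = A ->
  exists (d : 'I_n -> R) (P : 'M[R[i]%C]_n),
    [/\ char_poly A = \prod_i ('X - (d i)%:P), P \in unitmx &
        map_mx toC A =
          map_mx Num.conj P^T *m diag_mx (\row_i (d i)%:C%C) *m P].
Proof.
move=> symA; set Ac := map_mx toC A.
have hA : Ac \is hermsymmx.
  apply: realsym_hermsym.
    apply/is_hermitianmxP; rewrite expr0 scale1r map_mx_id //.
    by rewrite /Ac map_trmx symA.
  by apply/mxOverP => i j; rewrite mxE; apply/complex_realP; exists (A i j).
have /orthomx_spectralP eqA := hermitian_normalmx hA.
have dreal := hermitian_spectral_diag_real hA.
set P := spectralmx Ac in eqA; set D := spectral_diag Ac in eqA dreal.
pose d i := complex.Re (D 0 i).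
have dE : D = \row_i (d i)%:C%C.
  by apply/rowP => i; rewrite mxE RRe_real //; apply: (mxOverP dreal).
exists d, P; split; last 2 first.
- exact: spectral_unit.
- by rewrite -dE {1}eqA invmx_unitary // spectral_unitarymx.
apply: (map_poly_inj toC); rewrite map_char_poly -/Ac eqA.
rewrite char_poly_similar ?spectral_unit // char_poly_trig ?diag_mx_is_trig //.
rewrite rmorph_prod; apply: eq_bigr => i _ /=.
by rewrite rmorphB /= map_polyX map_polyC mxE eqxx mulr1n dE mxE.
Qed.

End Spectral.

Section Inertia.
Variable R : realType.
Implicit Types n : nat.

Lemma sum_mup_rootsR (Q : pred R) (s : seq R) (p := \prod_(x <- s) ('X - x%:P)) :
  (\sum_(x <- rootsR p | Q x) mup x p = count Q s)%N.
Proof.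
have p0 : p != 0 by apply/monic_neq0/monic_prod_XsubC.
have memp x : (x \in rootsR p) = (x \in s).
  by rewrite -(roots_on_rootsR p0) /= root_prod_XsubC.
rewrite (eq_bigr (fun x => count_mem x s)) => [|x _]; last exact: mu_prod_XsubC.
have perm : perm_eq (rootsR p) (undup s).
  by apply: uniq_perm; rewrite ?undup_uniq ?uniq_roots // => x; rewrite memp mem_undup.
rewrite (perm_big _ perm) /= -[RHS]sum1_count -[RHS]big_undup_iterop_count /=.
apply: eq_bigr => x _; rewrite Monoid.iteropE.
by elim: (count_mem x s) => //= k {1}->.
Qed.

Local Notation toC := (real_complex R).

(** Over the complex numbers a real symmetric matrix is unitarily
    diagonalizable, so its characteristic polynomial splits over the reals and
    counting its roots by sign counts the diagonal entries by sign. *)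
Lemma inertiaP n (A : 'M[R]_n) : A^T = A ->
  exists (d : 'I_n -> R) (P : 'M[R[i]%C]_n),
    [/\ pos_inertia A = #|[pred i | 0 < d i]|,
        neg_inertia A = #|[pred i | d i < 0]|, P \in unitmx &
        map_mx toC A =
          map_mx Num.conj P^T *m diag_mx (\row_i (d i)%:C%C) *m P].
Proof.
move=> /real_spectral[d [P [dE uP AE]]]; exists d, P.
have count_d (Q : pred R) : count Q [seq d i | i : 'I_n] = #|[pred i | Q (d i)]|.
  by rewrite -sum1_count big_map big_enum_cond /= sum1_card; apply: eq_card.
have pE : char_poly A = \prod_(x <- [seq d i | i : 'I_n]) ('X - x%:P).
  by rewrite dE big_map big_enum.
by split; rewrite // /pos_inertia /neg_inertia pE sum_mup_rootsR count_d.
Qed.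

Lemma inertia_rank n (A : 'M[R]_n) : A^T = A ->
  (pos_inertia A + neg_inertia A)%N = \rank A.
Proof.
move=> /inertiaP[d [P [-> -> uP AE]]].
rewrite -(mxrank_map toC) AE mxrankMfree ?row_free_unit //.
rewrite -mxrank_tr trmx_mul mxrankMfree; last first.
  by rewrite row_free_unit unitmx_tr map_unitmx unitmx_tr.
rewrite mxrank_tr mxrank_diag -cardUI addnC.
rewrite [X in (X + _)%N]eq_card0 ?add0n; last first.
  by move=> i; rewrite !inE; case: ltgtP.
apply: eq_card => i; rewrite !inE mxE eq_complex /= eqxx andbT.
by case: ltgtP.
Qed.

Lemma hermitian_diagE (C : numClosedFieldType) n (x g : 'rV[C]_n) :
  (x *m diag_mx g *m map_mx Num.conj x^T) 0 0 =
  \sum_i x 0 i * (x 0 i)^* * g 0 i.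
Proof.
by rewrite mul_mx_diag mxE; apply: eq_bigr => i _; rewrite !mxE mulrAC.
Qed.

(** One half of Sylvester's law of inertia.  Map the rows of W to their
    coordinates on the positive eigenvectors; a combination x of rows killed by
    this map has x A x^* <= 0 from the spectral side and >= 0 from e, hence
    vanishes against all other eigenvalues and x A = 0.  So the rank of W A is
    at most the number of positive eigenvalues. *)
Lemma congruence_pos_lb n k (A : 'M[R]_n) (d : 'I_n -> R) (P : 'M[R[i]%C]_n)
    (W : 'M_(k, n)) (e : 'rV_k) :
  map_mx toC A =
    map_mx Num.conj P^T *m diag_mx (\row_i (d i)%:C%C) *m P ->
  P \in unitmx ->
  W *m A *m W^T = diag_mx e -> (forall i, 0 <= e 0 i) ->
  (\rank (W *m A) <= #|[pred i | (0 < d i)%R]|)%N.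
Proof.
move=> AE uP WAW e_ge0.
pose Y := map_mx toC W *m map_mx Num.conj P^T.
pose J := \row_i ((0 < d i)%R%:R) : 'rV[R[i]%C]_n.
pose Q := Y *m diag_mx J.
have rkQ : (\rank Q <= #|[pred i | (0 < d i)%R]|)%N.
  apply: leq_trans (mxrankM_maxr _ _) _; rewrite mxrank_diag.
  rewrite leq_eqVlt; apply/orP; left; apply/eqP/eq_card => i; rewrite !inE mxE.
  by case: (0 < d i); rewrite ?oner_neq0 ?eqxx.
apply: leq_trans rkQ.
rewrite -(mxrank_map toC) map_mxM AE.
set D := diag_mx (\row_i (d i)%:C%C).
have DE : map_mx toC W *m (map_mx Num.conj P^T *m D *m P) = Y *m D *m P.
  by rewrite !mulmxA.
rewrite DE mxrankMfree ?row_free_unit //.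
have YDY : Y *m D *m map_mx Num.conj Y^T = diag_mx (map_mx toC e).
  rewrite -map_diag_mx -WAW !map_mxM AE -/D DE -[RHS]mulmxA; congr (_ *m _).
  rewrite /Y trmx_mul map_mxM map_trmx trmxK -map_mx_comp.
  rewrite [X in X *m _](map_mx_id (@conjCK _)); congr (_ *m _).
  by apply/matrixP=> i j; rewrite !mxE; exact: conj_real_complex.
have kerQ : (kermx Q <= kermx (Y *m D))%MS.
  apply/row_subP => r; set a := row r _.
  have aQ : a *m Q = 0 by apply/eqP; rewrite -sub_kermx row_sub.
  apply/sub_kermxP; rewrite mulmxA; set z := a *m Y.
  have z0 i : 0 < d i -> z 0 i = 0.
    move=> di; move/rowP/(_ i): aQ; rewrite mulmxA -/z mul_mx_diag !mxE di.
    by rewrite mulr1.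
  have zDz : z *m D *m map_mx Num.conj z^T =
             a *m diag_mx (map_mx toC e) *m map_mx Num.conj a^T.
    by rewrite -YDY /z trmx_mul map_mxM !mulmxA.
  have sumE : \sum_i z 0 i * (z 0 i)^* * (d i)%:C%C =
              \sum_i a 0 i * (a 0 i)^* * (e 0 i)%:C%C.
    move: (congr1 (fun M : 'M_1 => M 0 0) zDz); rewrite !hermitian_diagE => zE.
    transitivity (\sum_i z 0 i * (z 0 i)^* * (\row_i (d i)%:C%C) 0 i).
      by apply: eq_bigr => i _; rewrite mxE.
    by rewrite zE; apply: eq_bigr => i _; congr (_ * _); exact: mxE.
  have lhs_le0 i : true -> z 0 i * (z 0 i)^* * (d i)%:C%C <= 0.
    move=> _; have [di|di] := ltP 0 (d i); first by rewrite z0 // !mul0r.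
    by rewrite mulr_ge0_le0 ?mul_conjC_ge0 // -(rmorph0 toC) lecR.
  have /eqP : \sum_i z 0 i * (z 0 i)^* * (d i)%:C%C = 0.
    apply/eqP; rewrite eq_le sumr_le0 //= sumE sumr_ge0 // => i _.
    by rewrite mulr_ge0 ?mul_conjC_ge0 // ler0c.
  rewrite -oppr_eq0 -sumrN psumr_eq0 => [/allP zd0|i _]; last first.
    by rewrite oppr_ge0 lhs_le0.
  apply/rowP=> i; rewrite mul_mx_diag mxE [RHS]mxE [X in _ * X]mxE.
  have := zd0 i (mem_index_enum _); rewrite oppr_eq0 mulf_eq0 mul_conjC_eq0.
  by case/orP=> /eqP->; rewrite ?mul0r ?mulr0.
have := mxrankS kerQ; rewrite !mxrank_ker.
have := rank_leq_row Q; have := rank_leq_row (Y *m D).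
lia.
Qed.

Lemma inertia_lb n k (A : 'M[R]_n) (W : 'M_(k, n)) (e : 'rV_k) :
  A^T = A -> W *m A *m W^T = diag_mx e ->
  ((forall i, 0 <= e 0 i) -> (\rank (W *m A) <= pos_inertia A)%N) /\
  ((forall i, e 0 i <= 0) -> (\rank (W *m A) <= neg_inertia A)%N).
Proof.
move=> /inertiaP[d [P [-> -> uP AE]]] WAW; split=> e_sgn.
  exact: (congruence_pos_lb AE uP WAW).
have NAE : map_mx toC (- A) =
    map_mx Num.conj P^T *m diag_mx (\row_i (- d i)%:C%C) *m P.
  rewrite map_mxN AE -mulNmx -mulmxN; congr (_ *m _ *m _).
  by apply/matrixP=> i j; rewrite !mxE rmorphN mulNrn.
have NWAW : W *m - A *m W^T = diag_mx (- e).
  by rewrite mulmxN mulNmx WAW; apply/matrixP=> i j; rewrite !mxE mulNrn.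
rewrite -mxrank_opp -mulmxN.
have := congruence_pos_lb NAE uP NWAW.
rewrite (eq_card (B := [pred i | d i < 0])) => [|i]; last first.
  by rewrite !inE oppr_gt0.
by apply=> i; rewrite mxE oppr_ge0.
Qed.

Lemma isotropic_inertia_lb n k (A : 'M[R]_n) (W : 'M_(k, n)) :
  A^T = A -> W *m A *m W^T = 0 ->
  (\rank (W *m A) <= pos_inertia A)%N /\ (\rank (W *m A) <= neg_inertia A)%N.
Proof.
move=> symA WAW; have e0 : W *m A *m W^T = diag_mx 0.
  by rewrite WAW; apply/matrixP=> i j; rewrite !mxE mul0rn.
by have [le_p le_n] := inertia_lb symA e0; split; [apply: le_p|apply: le_n] => i; rewrite mxE.
Qed.

(** The sign of a term is negative when its boolean is true. *)
Definition signed_form n (L : seq (bool * 'rV[R]_n)) : 'M[R]_n :=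
  \sum_(p <- L) (-1) ^+ p.1 *: (p.2^T *m p.2).

Lemma signed_form_sym n (L : seq (bool * 'rV[R]_n)) :
  (signed_form L)^T = signed_form L.
Proof.
rewrite /signed_form raddf_sum; apply: eq_bigr => p _ /=.
by rewrite linearZ /= trmx_mul trmxK.
Qed.

(** Vectors dual to the rows give two bounds from below on the inertia; they add
    up to the number of terms, which bounds the rank from above. *)
Lemma inertia_signed_form n (L : seq (bool * 'rV[R]_n)) :
  free [seq p.2 | p <- L] ->
  pos_inertia (signed_form L) = count (fun p => ~~ p.1) L /\
  neg_inertia (signed_form L) = count (fun p => p.1) L.
Proof.
move=> freeL; pose k := size L; pose p0 := (false, 0 : 'rV[R]_n).
pose X := \matrix_(i < k) (nth p0 L i).2.
pose g := \row_(i < k) (-1) ^+ (nth p0 L i).1 : 'rV[R]_k.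
have formE : signed_form L = X^T *m diag_mx g *m X.
  rewrite /signed_form (big_nth p0) big_mkord; apply/matrixP=> a b.
  rewrite summxE -mulmxA mul_diag_mx [RHS]mxE; apply: eq_bigr => i _.
  by rewrite !mxE big_ord1 !mxE mulrCA mulrA.
have Xfree : row_free X.
  apply: inj_row_free => v vX0; apply/rowP=> i; rewrite mxE.
  have sz : size [seq p.2 | p <- L] == k by rewrite size_map.
  apply: (freeP (X := Tuple sz) freeL) i; rewrite -[RHS]vX0 mulmx_sum_row.
  apply: eq_bigr => i _; congr (_ *: _); apply/rowP=> j.
  by rewrite !mxE /= (nth_map p0).
have /row_freeP[Y XY] := Xfree.
have symA := signed_form_sym L; set A := signed_form L in formE symA *.
have rkA : (\rank A <= k)%N.
  by rewrite formE; apply: leq_trans (mxrankM_maxr _ _) _; rewrite rank_leq_row.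
have WAW (Q : pred bool) : let W := diag_mx (\row_i (Q (nth p0 L i).1)%:R) *m Y^T in
    W *m A *m W^T = diag_mx (\row_i (if Q (nth p0 L i).1 then g 0 i else 0)).
  rewrite /= formE trmx_mul trmxK tr_diag_mx !mulmxA -[_ *m Y^T *m X^T]mulmxA.
  rewrite -trmx_mul XY trmx1 mulmx1 -[_ *m X *m Y]mulmxA XY mulmx1 !mulmx_diag.
  congr diag_mx; apply/rowP=> i; rewrite !mxE.
  by case: (Q _); rewrite ?mul0r // mul1r mulr1.
have count_le (Q : pred bool) : let W := diag_mx (\row_i (Q (nth p0 L i).1)%:R) *m Y^T in
    (count (fun p => Q p.1) L <= \rank (W *m A))%N.
  move=> W; have := mxrankM_maxl (W *m A) W^T; rewrite WAW mxrank_diag.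
  apply: leq_trans; rewrite -sum1_count (big_nth p0) big_mkord sum1_card.
  rewrite leq_eqVlt; apply/orP; left; apply/eqP/eq_card => i.
  by rewrite unfold_in inE !mxE; case: (Q _); rewrite ?eqxx ?signr_eq0.
have [le_pos _] := inertia_lb symA (WAW negb).
have [_ le_neg] := inertia_lb symA (WAW id).
have pos_ge : (count (fun p => ~~ p.1) L <= pos_inertia A)%N.
  apply: leq_trans (count_le negb) _; apply: le_pos => i; rewrite !mxE.
  by case: (nth p0 L i).1 => //=; rewrite expr0 ler01.
have neg_ge : (count (fun p => p.1) L <= neg_inertia A)%N.
  apply: leq_trans (count_le id) _; apply: le_neg => i; rewrite !mxE.
  by case: (nth p0 L i).1 => //=; rewrite expr1 lerN10.
have rkE := inertia_rank symA.
have kE : (count (fun p => p.1) L + count (fun p => ~~ p.1) L)%N = k.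
  exact: count_predC.
lia.
Qed.
End Inertia.

(** * Paths and cycles as sequences *)

Section PathAdjacency.
Variable T : eqType.
Implicit Types (s : seq T) (x y v : T).

Fixpoint succ_in s x y : bool :=
  if s is a :: t then
    (if t is b :: _ then (x == a) && (y == b) else false) || succ_in t x y
  else false.

Definition path_adj s x y := succ_in s x y || succ_in s y x.

Lemma path_adjC s x y : path_adj s x y = path_adj s y x.
Proof. exact: orbC. Qed.

Lemma succ_in_mem s x y : succ_in s x y -> (x \in s) && (y \in behead s).
Proof.
elim: s => //= a [|b t] IHs //= /orP[/andP[/eqP-> /eqP->]|/IHs/andP[xt yt]].
  by rewrite !mem_head.
by rewrite !in_cons in xt yt *; rewrite xt yt !orbT.
Qed.

Lemma path_adj_mem s x y : path_adj s x y -> (x \in s) && (y \in s).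
Proof.
by case/orP=> /succ_in_mem/andP[-> /mem_behead->].
Qed.

Lemma succ_in_index s x y : uniq s ->
  succ_in s x y = [&& x \in s, y \in s & index y s == (index x s).+1].
Proof.
elim: s => //= a t IHt /andP[at' ut]; rewrite IHt // !in_cons.
have [->|xa] := eqVneq x a.
  rewrite (negPf at') /=; case: t {IHt ut} at' => [|b t] at' //=.
    by rewrite in_nil orbF; case: eqVneq.
  rewrite in_cons negb_or in at'; case/andP: at' => ab at'.
  have [->|yb] := eqVneq y b; first by rewrite (negPf ab) mem_head orbT eqxx.
  by case: eqVneq => //= ya; rewrite !eqSS andbF.
have -> : (if t is b :: _ then false && (y == b) else false) = false by case: (t).
have [->|ya] := eqVneq y a => //=.
by rewrite (negPf at') /= andbF.
Qed.

Lemma succ_in_cat s1 a s2 x y :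
  succ_in (s1 ++ a :: s2) x y = succ_in (rcons s1 a) x y || succ_in (a :: s2) x y.
Proof.
elim: s1 => [|b s1 IHs] //=; rewrite {}IHs orbA; congr (_ || _ || _).
by case: s1.
Qed.

Lemma path_adj_cat s1 a s2 x y :
  path_adj (s1 ++ a :: s2) x y =
  path_adj (rcons s1 a) x y || path_adj (a :: s2) x y.
Proof. by rewrite /path_adj !succ_in_cat orbACA. Qed.

Lemma path_adj_cons a b s x y :
  path_adj [:: a, b & s] x y =
  [|| (x == a) && (y == b), (y == a) && (x == b) | path_adj (b :: s) x y].
Proof. by rewrite /path_adj /= orbACA -!orbA. Qed.

Lemma path_adj_head a b s y : uniq [:: a, b & s] ->
  path_adj [:: a, b & s] a y = (y == b).
Proof.
rewrite cons_uniq => /andP[abs _]; rewrite path_adj_cons eqxx /=.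
have -> : (a == b) = false by apply: contraNF abs => /eqP->; rewrite mem_head.
rewrite andbF /=; case: eqP => //= _; apply: contraNF abs.
by case/path_adj_mem/andP.
Qed.

(** Stated for next_at because the induction keeps the closing vertex v0 while
    the head of the sequence moves. *)
Lemma next_at_succ_in v0 v s x y : uniq (v :: s) -> x \in v :: s ->
  (next_at x v0 v s == y) =
  succ_in (v :: s) x y || ((x == last v s) && (y == v0)).
Proof.
elim: s v => [|a s IHs] v /=.
  by rewrite inE => _ /eqP->; rewrite eqxx /= eq_sym.
move=> /andP[vas uas]; rewrite in_cons.
have [->|xv] := eqVneq x v => /=.
  move=> _; rewrite (eq_sym a).
  have -> : (v == last a s) = false.
    by apply: contraNF vas => /eqP->; apply: mem_last.
  case: eqP => //= _; rewrite orbF; apply/esym; apply: contraNF vas.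
  by case/(@succ_in_mem (a :: s))/andP.
by move=> xas; apply: IHs.
Qed.

Lemma next_succ_in v s x y : uniq (v :: s) -> x \in v :: s ->
  (next (v :: s) x == y) = succ_in (v :: s) x y || ((x == last v s) && (y == v)).
Proof. exact: next_at_succ_in. Qed.

End PathAdjacency.

Section Pieces.
Variable V : finType.
Implicit Types (G H P C : sgraph V) (v : V).

Lemma path_fromP v P : is_path_from v P ->
  exists a t, [/\ uniq [:: v, a & t], verts P = [set x in [:: v, a & t]] &
    edge P =2 path_adj [:: v, a & t]].
Proof.
case=> -[|a t] [// _ us vP eP]; exists a, t; split=> // x y.
rewrite eP /path_adj !succ_in_index //.
by case: (x \in _); case: (y \in _).
Qed.

Lemma cycle_rootP v C : is_cycle C -> v \in verts C ->
  exists s, [/\ (2 <= size s)%N, uniq (v :: s), verts C = [set x in v :: s] &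
    forall x y, edge C x y = [|| path_adj (v :: s) x y,
      (x == last v s) && (y == v) | (y == last v s) && (x == v)]].
Proof.
case=> s0 [sz us0 vC eC]; rewrite vC inE => vs0.
have [i s rotE] := rot_to vs0; exists s.
have memE x : (x \in s0) = (x \in v :: s) by rewrite -rotE mem_rot.
have us : uniq (v :: s) by rewrite -rotE rot_uniq.
split=> //.
- by rewrite -ltnS -[(size s).+1]/(size (v :: s)) -rotE size_rot.
- by apply/setP=> x; rewrite !inE memE inE.
move=> x y; rewrite eC !memE -!(next_rot i us0) rotE.
have [xs|xs] := boolP (x \in v :: s); last first.
  apply/esym/negbTE; apply: contra xs.
  case/or3P=> [/path_adj_mem/andP[]//|/andP[/eqP-> _]|/andP[_ /eqP->]].
    exact: mem_last.
  exact: mem_head.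
have [ys|ys] := boolP (y \in v :: s); last first.
  apply/esym/negbTE; apply: contra ys.
  case/or3P=> [/path_adj_mem/andP[]//|/andP[_ /eqP->]|/andP[/eqP-> _]].
    exact: mem_head.
  exact: mem_last.
by rewrite !next_succ_in // orbACA -!orbA.
Qed.

End Pieces.

(** * Decomposition of a pulsar *)

Section Hanging.
Variable V : finType.
Implicit Types (F G H S B C : sgraph V) (u v x y z : V).


Lemma edge_mem H x y : edge H x y -> (x \in verts H) && (y \in verts H).
Proof.
by move=> e; rewrite (edge_verts e) /=; move: e; rewrite edge_sym => /edge_verts.
Qed.

(** H is a part of G that meets the rest of G only at v. *)
Definition hangs G H v : Prop :=
  [/\ verts H \subset verts G, subrel (edge H) (edge G) &
      forall y z, y \in verts H -> y != v -> edge G y z -> edge H y z].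

Lemma hangs_trans G F H v : hangs G F v -> hangs F H v -> hangs G H v.
Proof.
case=> FG eFG GF [HF eHF FH]; split; first exact: subset_trans HF FG.
  by move=> x y /eHF/eFG.
by move=> y z yH yv /(GF _ _ (subsetP HF _ yH) yv)/(FH _ _ yH yv).
Qed.

Lemma shared_vertex F H v x : verts F :&: verts H = [set v] ->
  x \in verts F -> x \in verts H -> x = v.
Proof.
move=> FH xF xH; apply/set1P; rewrite -FH inE xF; exact: xH.
Qed.

Lemma vertex_sum_hangs F v H G : vertex_sum F v H G -> hangs G F v /\ hangs G H v.
Proof.
case=> FH vG eG; split; split.
- by rewrite vG subsetUl.
- by move=> x y e; rewrite eG e.
- move=> y z yF yv; rewrite eG => /orP[//|/edge_mem/andP[yH _]].
  by rewrite (shared_vertex FH yF yH) eqxx in yv.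
- by rewrite vG subsetUr.
- by move=> x y e; rewrite eG e orbT.
- move=> y z yH yv; rewrite eG => /orP[/edge_mem/andP[yF _]|//].
  by rewrite (shared_vertex FH yF yH) eqxx in yv.
Qed.

Lemma joined_at_hangs k (P : 'I_k -> sgraph V) v G i :
  joined_at P v G -> hangs G (P i) v.
Proof.
case=> _ PP vG eG; split.
- by rewrite vG (bigcup_sup i).
- by move=> x y e; rewrite eG; apply/existsP; exists i.
- move=> y z yi yv; rewrite eG => /existsP[j].
  have [-> //|ji /edge_mem/andP[yj _]] := eqVneq j i.
  by rewrite (shared_vertex (PP _ _ ji) yj yi) eqxx in yv.
Qed.

(** The decomposition of a pulsar in a form symmetric in the two centers. *)
Definition pulsar_parts alpha1 beta1 alpha2 beta2 F C H v u G : Prop :=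
  [/\ is_supernova alpha1 beta1 v F, is_supernova alpha2 beta2 u H,
      is_cycle C, v != u & ~~ edge C v u] /\
  [/\ [disjoint verts F & verts H], verts F :&: verts C = [set v],
      verts H :&: verts C = [set u],
      verts G = verts F :|: verts C :|: verts H &
      forall x y, edge G x y = [|| edge F x y, edge C x y | edge H x y]].

Lemma is_pulsar_parts alpha1 beta1 alpha2 beta2 G :
  is_pulsar alpha1 beta1 alpha2 beta2 G ->
  exists F C H v u, pulsar_parts alpha1 beta1 alpha2 beta2 F C H v u G.
Proof.
case=> F [C [H [v [u [[sF sH dFH] [[cC vC uC vu nvu]]]]]]].
case=> FC [[FiC vFC eFC] [FCiH vG eG]]; exists F, C, H, v, u; split; split=> //.
- apply/setP=> x; move/setP/(_ x): (FCiH); rewrite vFC !inE.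
  have [-> _|xu] := eqVneq x u; last by case: (x \in verts F); case: (x \in verts C); case: (x \in verts H).
  by move/setP/(_ u): FCiH; rewrite !inE eqxx uC andbT => /andP[].
- by rewrite vG vFC.
- by move=> x y; rewrite eG eFC orbA.
Qed.

Lemma pulsar_parts_sym alpha1 beta1 alpha2 beta2 F C H v u G :
  pulsar_parts alpha1 beta1 alpha2 beta2 F C H v u G ->
  pulsar_parts alpha2 beta2 alpha1 beta1 H C F u v G.
Proof.
case=> [[sF sH cC vu nvu] [dFH FC HC vG eG]]; split; split=> //.
- by rewrite eq_sym.
- by rewrite edge_sym.
- by rewrite disjoint_sym.
- by rewrite vG -setUA setUC (setUC (verts C)).
- by move=> x y; rewrite eG orbA orbC (orbC (edge F x y)).
Qed.

Lemma pulsar_parts_hangs alpha1 beta1 alpha2 beta2 F C H v u G :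
  pulsar_parts alpha1 beta1 alpha2 beta2 F C H v u G -> hangs G F v.
Proof.
case=> [[sF sH cC vu nvu] [dFH FC HC vG eG]]; split.
- by rewrite vG -setUA subsetUl.
- by move=> x y e; rewrite eG e.
- move=> y z yF yv; rewrite eG => /or3P[//|/edge_mem/andP[yC _]|/edge_mem/andP[yH _]].
    by rewrite (shared_vertex FC yF yC) eqxx in yv.
  by move/disjoint_setI0/setP/(_ y): dFH; rewrite !inE yF yH.
Qed.

(** Both arcs of the connecting cycle between the centers are nonempty because
    v and u are not adjacent; a begins the arc that leaves v, and b ends the
    arc that returns to it. *)
Lemma pulsar_cycle alpha1 beta1 alpha2 beta2 F C H v u G :
  pulsar_parts alpha1 beta1 alpha2 beta2 F C H v u G ->
  exists a s b t,
    [/\ uniq [:: v, a & s ++ u :: rcons t b],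
        verts C = [set x in [:: v, a & s ++ u :: rcons t b]] &
      forall x y, edge C x y =
        [|| path_adj [:: v, a & s ++ u :: rcons t b] x y,
            (x == b) && (y == v) | (y == b) && (x == v)]].
Proof.
case=> [[sF sH cC vu nvu] [dFH FC HC vG eG]].
have vC : v \in verts C by move/setP/(_ v): FC; rewrite !inE eqxx => /andP[].
have uC : u \in verts C by move/setP/(_ u): HC; rewrite !inE eqxx => /andP[].
have [s [sz us vsC eC]] := cycle_rootP cC vC.
have us' : u \in s by move: uC; rewrite vsC !inE eq_sym (negPf vu).
case/splitPr: s / us' sz us vsC eC => s1 s2 sz us vsC eC.
case: s1 sz us vsC eC => [|a s] sz us vsC eC.
  by move: nvu; rewrite eC path_adj_head // eqxx.
case/lastP: s2 sz us vsC eC => [|t b] sz us vsC eC.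
  by move: nvu; rewrite eC cats1 last_rcons !eqxx /= !orbT.
exists a, s, b, t; split=> // x y.
by rewrite eC last_cat /= last_rcons.
Qed.

End Hanging.

(** * Zero forcing *)

Section ZeroForcing.
Variables (R : realType) (n : nat) (G : sgraph 'I_n) (A : 'M[R]_n).
Hypothesis patternA : forall i j, i != j -> (A i j != 0) = edge G i j.
Implicit Types (x w : 'rV[R]_n) (Z : {set 'I_n}) (H B P C S : sgraph 'I_n).

Definition vanishes x Z := forall y, y \in Z -> x 0 y = 0.

Lemma vanishesU x Y Z : vanishes x (Y :|: Z) <-> vanishes x Y /\ vanishes x Z.
Proof.
split=> [h|[hY hZ] y]; last by rewrite inE => /orP[/hY|/hZ].
by split=> y yY; apply: h; rewrite inE yY ?orbT.
Qed.

Lemma vanishes1 x y : vanishes x [set y] <-> x 0 y = 0.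
Proof. by split=> [->//|h z /set1P->]; rewrite ?set11. Qed.

Lemma mulmx_coord x y : (x *m A) 0 y = \sum_z x 0 z * A z y.
Proof. by rewrite mxE. Qed.

(** The zero forcing rule: if row y of A annihilates x, and x vanishes at y and
    at all neighbors of y but one, it vanishes at the last one too. *)
Lemma force x y c : (x *m A) 0 y = 0 -> x 0 y = 0 -> edge G y c ->
  (forall z, edge G y z -> z != c -> x 0 z = 0) -> x 0 c = 0.
Proof.
move=> xAy xy yc xz; have cy : c != y.
  by apply: contraTneq yc => ->; rewrite edge_irr.
have Acy : A c y != 0 by rewrite patternA // edge_sym.
move: xAy; rewrite mulmx_coord (bigD1 c) //= big1 ?addr0 => [/eqP|z zc].
  by rewrite mulf_eq0 (negPf Acy) orbF => /eqP.
have [->|zy] := eqVneq z y; first by rewrite xy mul0r.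
have [yz|/negbTE nyz] := boolP (edge G y z); first by rewrite xz // mul0r.
have /negbFE/eqP-> : (A z y != 0) = false by rewrite patternA // edge_sym.
by rewrite mulr0.
Qed.

(** Two consecutive zeros propagate along a path whose vertices, from the second
    to the last but one, have no neighbor outside the path.  The last vertex
    is reached without using its own row, so it may have further neighbors. *)
Lemma chain_force x a b s :
  uniq [:: a, b & s] -> x 0 a = 0 -> x 0 b = 0 ->
  (forall y z, path_adj [:: a, b & s] y z -> edge G y z) ->
  (forall y z, y \in belast b s -> edge G y z -> path_adj [:: a, b & s] y z) ->
  (forall y, y \in belast b s -> (x *m A) 0 y = 0) ->
  vanishes x [set y in b :: s].
Proof.
elim: s a b => [|c s IHs] a b us xa xb sub loc rows.
  by move=> y; rewrite !inE => /eqP->.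
have bE : path_adj [:: a, b, c & s] b =1 pred2 a c.
  move=> z; rewrite path_adj_cons path_adj_head; last by case/andP: us.
  have /negbTE-> : b != a.
    by apply: contraTneq us => ->; rewrite /= mem_head.
  by rewrite eqxx /= andbT.
have xc : x 0 c = 0.
  apply: (@force x b) => //; first by apply: rows; rewrite mem_head.
    by apply: sub; rewrite bE /= eqxx orbT.
  move=> z bz zc; have := loc b z; rewrite mem_head => /(_ isT bz).
  by rewrite bE /= (negPf zc) orbF => /eqP->.
have us' : uniq [:: b, c & s] by case/andP: us.
have van : vanishes x [set y in c :: s].
  apply: (IHs b) => //.
  - by move=> y z yz; apply: sub; rewrite path_adj_cons yz !orbT.
  - move=> y z ys yz; have := loc y z; rewrite /= in_cons ys orbT => /(_ isT yz).
    have ycs : y \in c :: s by apply: mem_belast.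
    have ya : y != a.
      by apply: contraTneq us => <-; rewrite /= in_cons ycs orbT.
    have yb : y != b by apply: contraTneq us' => <-; rewrite /= ycs.
    by rewrite path_adj_cons (negPf ya) (negPf yb) andbF.
  - by move=> y ys; apply: rows; rewrite /= in_cons ys orbT.
move=> y; rewrite inE in_cons => /orP[/eqP->//|ys]; apply: van.
by rewrite inE.
Qed.

Lemma path_force x v a t P :
  uniq [:: v, a & t] -> verts P = [set x in [:: v, a & t]] ->
  edge P =2 path_adj [:: v, a & t] -> hangs G P v ->
  (forall y, y \in verts P -> y != v -> (x *m A) 0 y = 0) ->
  x 0 v = 0 -> x 0 a = 0 -> vanishes x (verts P).
Proof.
move=> us vP eP [_ sub loc] rows xv xa.
have inP y : y \in belast a t -> y \in verts P /\ y != v.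
  move=> /mem_belast yat; rewrite vP inE in_cons yat orbT; split=> //.
  by apply: contraTneq us => <-; rewrite /= yat.
have van : vanishes x [set y in a :: t].
  apply: (@chain_force x v) => //.
  - by move=> y z; rewrite -eP; apply: sub.
  - by move=> y z /inP[yP yv] yz; rewrite -eP; apply: loc.
  - by move=> y /inP[yP yv]; apply: rows.
move=> y; rewrite vP inE in_cons => /orP[/eqP->//|yat].
by apply: van; rewrite inE.
Qed.

Lemma cycle_force x v s C : (0 < size s)%N ->
  uniq (v :: s) -> verts C = [set x in v :: s] ->
  (forall y z, edge C y z = [|| path_adj (v :: s) y z,
      (y == last v s) && (z == v) | (z == last v s) && (y == v)]) ->
  hangs G C v ->
  (forall y, y \in verts C -> y != v -> (x *m A) 0 y = 0) ->
  x 0 v = 0 -> x 0 (head v s) = 0 -> vanishes x (verts C).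
Proof.
case: s => // a t _ us vC eC [_ sub loc] rows xv xa.
have inC y : y \in belast a t -> y \in verts C /\ y != v.
  move=> /mem_belast yat; rewrite vC inE in_cons yat orbT; split=> //.
  by apply: contraTneq us => <-; rewrite /= yat.
have van : vanishes x [set y in a :: t].
  apply: (@chain_force x v) => //.
  - by move=> y z yz; apply: sub; rewrite eC yz.
  - move=> y z yat yz; have [yC yv] := inC _ yat.
    have := loc _ _ yC yv yz; rewrite eC (negPf yv) andbF orbF /=.
    case/orP=> // /andP[/eqP yl _]; move: yat us; rewrite yl => lat.
    by rewrite cons_uniq lastI rcons_uniq lat andbF.
  - by move=> y /inC[yC yv]; apply: rows.
move=> y; rewrite vC inE in_cons => /orP[/eqP->//|yat].
by apply: van; rewrite inE.
Qed.

Definition rows_vanish x H v :=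
  forall y, y \in verts H -> y != v -> (x *m A) 0 y = 0.

Lemma bouquet_forcing k v B : is_bouquet k v B -> hangs G B v ->
  exists2 Z : {set 'I_n}, (#|Z| <= k)%N &
    forall x, rows_vanish x B v -> x 0 v = 0 -> vanishes x Z ->
      vanishes x (verts B).
Proof.
case=> _ [C [cC jC]] hB; have [vC _ vB _] := jC.
have /fin_all_exists[s sP] i := cycle_rootP (cC i) (vC i).
exists [set head v (s i) | i : 'I_k].
  by apply: leq_trans (leq_imset_card _ _) _; rewrite card_ord.
move=> x rows xv xZ y; rewrite vB => /bigcupP[i _].
have [sz us vCi eCi] := sP i.
apply: (cycle_force (ltnW sz) us vCi eCi) => //.
- exact: hangs_trans hB (joined_at_hangs i jC).
- by move=> z zC; apply: rows; rewrite vB; apply/bigcupP; exists i.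
- by apply: xZ; apply/imsetP; exists i.
Qed.

(** Z is the set of the starts of all pendant paths but the first, which starts
    at w0. *)
Lemma star_forcing k v S : is_generalized_star k v S -> hangs G S v ->
  exists (w0 : 'I_n) (Z : {set 'I_n}), [/\ (#|Z| < k)%N, edge G v w0 &
    forall x, rows_vanish x S v -> x 0 v = 0 -> vanishes x Z ->
      (forall y, edge S v y -> y != w0 -> x 0 y = 0) /\
      (x 0 w0 = 0 -> vanishes x (verts S))].
Proof.
case: k => [|k] [// _ [P [pP jP]]] hS; have [_ _ vS eS] := jP.
have /fin_all_exists[h /fin_all_exists[t tP]] i := path_fromP (pP i).
have hangP i := hangs_trans hS (joined_at_hangs i jP).
exists (h ord0), [set h i | i in [set~ ord0]]; split.
- by rewrite ltnS; apply: leq_trans (leq_imset_card _ _) _; rewrite cardsC1 card_ord.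
- have [us _ eP] := tP ord0; case: (hangP ord0) => _ sub _.
  by apply: sub; rewrite eP path_adj_head.
move=> x rows xv xZ.
have xh i : i != ord0 -> x 0 (h i) = 0.
  by move=> i0; apply: xZ; apply/imsetP; exists i; rewrite ?inE.
split=> [y|xh0].
  rewrite eS => /existsP[j]; have [us _ eP] := tP j.
  rewrite eP path_adj_head // => /eqP-> hj.
  by apply: xh; apply: contra_neq hj => ->.
move=> y; rewrite vS => /bigcupP[i _].
have [us vP eP] := tP i; apply: (path_force us vP eP) => //.
- by move=> z zP; apply: rows; rewrite vS; apply/bigcupP; exists i.
- by have [->|/xh] := eqVneq i ord0.
Qed.

(** In the second case w is a null vector of the matrix of one pendant path.  It
    is then nonzero at the vertex of the path next to v, as it would be zero
    by forcing otherwise, and that vertex is the only one of the path seen by v: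
    hence c is nonzero. *)
Lemma star_dichotomy k v S : is_generalized_star k v S -> hangs G S v ->
  (forall x, rows_vanish x S v -> x 0 v = 0 -> vanishes x (verts S)) \/
  (exists w c, [/\ c != 0, w *m A = c *: delta_mx 0 v, w 0 v = 0 &
     forall y, y \notin verts S -> w 0 y = 0]).
Proof.
case=> _ [P [pP jP]] hS; have [_ _ vS eS] := jP.
have hangP i := hangs_trans hS (joined_at_hangs i jP).
have [[i [w [w0 [wv wP rows]]]]|nsing] := pselect (exists i w,
    w != 0 /\ [/\ w 0 v = 0, forall y, y \notin verts (P i) -> w 0 y = 0 &
              rows_vanish w (P i) v]).
  right; have [h [t [us vP eP]]] := path_fromP (pP i).
  have [_ sub loc] := hangP i.
  exists w, ((w *m A) 0 v); split=> //.
  - apply: contra_neq w0 => wAv; apply/rowP=> y; rewrite mxE.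
    have [yP|] := boolP (y \in verts (P i)); last exact: wP.
    apply: (path_force us vP eP (hangP i)) => //.
    apply: (@force w v) => //; first by apply: sub; rewrite eP path_adj_head.
    move=> z vz zh; have [zP|] := boolP (z \in verts (P i)); last exact: wP.
    have [->//|zv] := eqVneq z v.
    have := loc z v zP zv; rewrite edge_sym => /(_ vz).
    by rewrite eP path_adjC path_adj_head // (negPf zh).
  - apply/rowP=> y; rewrite [RHS]mxE [X in _ * X]mxE eqxx /=.
    have [->|yv] := eqVneq y v; first by rewrite mulr1.
    rewrite mulr0; have [yP|yP] := boolP (y \in verts (P i)); first exact: rows.
    rewrite mulmx_coord big1 // => z _.
    have [zP|zP] := boolP (z \in verts (P i)); last by rewrite wP // mul0r.
    have [->|zv] := eqVneq z v; first by rewrite wv mul0r.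
    have zy : z != y by apply: contraNneq yP => <-.
    have /negbFE/eqP-> : (A z y != 0) = false.
      rewrite patternA //; apply: contraNF yP => /(loc _ _ zP zv).
      by case/edge_mem/andP.
    by rewrite mulr0.
  - move=> y yS; apply: wP; apply: contra yS => yP.
    by rewrite vS; apply/bigcupP; exists i.
left=> x rows xv y; rewrite vS => /bigcupP[i _ yP].
have [_ sub loc] := hangP i.
apply/eqP; apply/negPn/negP => xy; apply: nsing.
pose w := \row_z (if z \in verts (P i) then x 0 z else 0).
have wE z : w 0 z = if z \in verts (P i) then x 0 z else 0 by rewrite mxE.
exists i, w; split.
  by apply: contra_neq xy => w0; have := wE y; rewrite yP w0 mxE.
split.
- by rewrite wE xv if_same.
- by move=> z zP; rewrite wE (negPf zP).
move=> z zP zv; rewrite -[RHS](rows z) //; last first.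
  by rewrite vS; apply/bigcupP; exists i.
rewrite !mulmx_coord; apply: eq_bigr => j _; rewrite wE.
have [//|jNP] := boolP (j \in verts (P i)).
have jz : j != z by apply: contraNneq jNP => ->.
have /negbFE/eqP-> : (A j z != 0) = false.
  rewrite patternA // edge_sym; apply: contraNF jNP => /(loc _ _ zP zv).
  by case/edge_mem/andP.
by rewrite !mulr0.
Qed.

(** Restriction to Z is injective on the kernel of A. *)
Lemma corank_forcing Z :
  (forall x, x *m A = 0 -> vanishes x Z -> x = 0) -> (n <= \rank A + #|Z|)%N.
Proof.
move=> forcing; pose E : 'M[R]_n := diag_mx (\row_i (i \in Z)%:R).
have rkE : \rank E = #|Z|.
  by rewrite mxrank_diag; apply: eq_card => i; rewrite inE mxE; case: (i \in Z); rewrite ?oner_neq0 ?eqxx.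
have cap0 : (kermx A :&: kermx E)%MS = 0.
  apply/eqP; rewrite -submx0; apply/row_subP => i; set x := row i _.
  have : (x <= kermx A :&: kermx E)%MS by apply: row_sub.
  rewrite sub_capmx => /andP[/sub_kermxP xA /sub_kermxP xE].
  rewrite (forcing x xA) ?sub0mx // => y yZ.
  by move/rowP/(_ y): xE; rewrite mul_mx_diag mxE [X in _ * X]mxE [RHS]mxE yZ mulr1.
have := mxrank_sum_cap (kermx A) (kermx E).
rewrite cap0 mxrank0 !mxrank_ker rkE.
have := rank_leq_col (kermx A + kermx E)%MS.
have := rank_leq_row A; have := max_card (mem Z); rewrite card_ord.
lia.
Qed.

End ZeroForcing.

Section PulsarForcing.
Variables (R : realType) (n : nat) (G : sgraph 'I_n) (A : 'M[R]_n).
Hypothesis patternA : forall i j, i != j -> (A i j != 0) = edge G i j.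
Implicit Types (x w : 'rV[R]_n) (Z : {set 'I_n}) (F H B P C S : sgraph 'I_n).

(** Z has one vertex in each cycle and Z' the starts of all pendant paths but
    that of p0, which can only be forced from outside, through row v. *)
Lemma supernova_forcing al be v F : is_supernova al be v F -> hangs G F v ->
  exists p0 Z Z', [/\ (#|Z| <= al)%N, (#|Z'| < be)%N, edge G v p0,
    forall x, x *m A = 0 -> x 0 v = 0 -> vanishes x Z -> vanishes x Z' ->
      (forall y, edge F v y -> y != p0 -> x 0 y = 0) /\
      (x 0 p0 = 0 -> vanishes x (verts F)) &
    (forall x, x *m A = 0 -> x 0 v = 0 -> vanishes x Z ->
       vanishes x (verts F)) \/
    (exists w c, [/\ c != 0, w *m A = c *: delta_mx 0 v, w 0 v = 0 &
       forall y, y \notin verts F -> w 0 y = 0])].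
Proof.
case=> S [B [starS bouqB SB]] hF; have [hS hB] := vertex_sum_hangs SB.
have [_ vF eF] := SB; have := hangs_trans hF hB; have := hangs_trans hF hS.
move=> {hF}hS {}hB.
have [p0 [Z' [cZ' vw0 forceS]]] := star_forcing patternA starS hS.
have [Z cZ forceB] := bouquet_forcing patternA bouqB hB.
have rows x Q : x *m A = 0 -> rows_vanish A x Q v.
  by move=> xA y _ _; rewrite xA mxE.
exists p0, Z, Z'; split=> //.
  move=> x xA xv xZ xZ'; have [xS xSp0] := forceS x (rows _ _ xA) xv xZ'.
  have xB := forceB x (rows _ _ xA) xv xZ; split=> [y|xw0].
    by rewrite eF => /orP[/xS//|/edge_mem/andP[_ yB] _]; apply: xB.
  by rewrite vF; apply/vanishesU; split=> //; apply: xSp0.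
have [nonsing|[w [c [c0 wA wv wS]]]] := star_dichotomy patternA starS hS.
  left=> x xA xv xZ; rewrite vF; apply/vanishesU; split.
    exact: nonsing (rows _ _ xA) xv.
  exact: forceB (rows _ _ xA) xv xZ.
right; exists w, c; split=> // y yF; apply: wS; apply: contra yF => yS.
by rewrite vF inE yS.
Qed.

(** The vertices a and d start the arc from v to u and the arc from u back to v.
    From v and a the zeros run along the first arc up to u itself; then row u
    forces d as soon as the second supernova is zero, and the zeros continue
    along the other arc. *)
Lemma connecting_cycle_forcing al1 be1 al2 be2 F C H v u :
  pulsar_parts al1 be1 al2 be2 F C H v u G ->
  exists a d, forall x, x *m A = 0 -> x 0 v = 0 -> x 0 a = 0 ->
    [/\ x 0 u = 0, (x 0 d = 0 -> vanishes x (verts C)) &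
        (forall y, edge H u y -> x 0 y = 0) -> x 0 d = 0].
Proof.
move=> pG; have [a [s [b [t]]]] := pulsar_cycle pG.
case: pG => [[sF sH cC vu nvu] [dFH FC HC vG eG]].
set tb := rcons t b; have [d [r tbE]] : exists d r, tb = d :: r.
  by rewrite /tb; case: (t) => [|d r] /=; eexists; eexists.
have lastr : last d r = b by rewrite -[LHS]/(last d (d :: r)) -tbE last_rcons.
rewrite tbE => -[us vC eC]; exists a, d => x xA xv xa.
have rows y : (x *m A) 0 y = 0 by rewrite xA mxE.
have := us; rewrite -[[:: v, a & _]]/(v :: (a :: s) ++ [:: u, d & r]).
rewrite cons_uniq cat_uniq mem_cat negb_or => /andP[/andP[vas vudr]].
case/and3P=> [_ /hasPn hn uas].
have disj y : y \in a :: s -> y \in [:: u, d & r] -> False.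
  by move=> yas /hn; rewrite /= yas.
have notv y : y \in a :: s \/ y \in [:: u, d & r] -> y != v.
  by case=> [yas|yudr]; [apply: contraNneq vas|apply: contraNneq vudr] => <-.
have vCE : verts C =i v :: (a :: s) ++ [:: u, d & r] by move=> y; rewrite vC inE.
have memC y : y \in a :: s \/ y \in [:: u, d & r] -> y \in verts C.
  by move=> yc; rewrite vCE in_cons mem_cat; case: yc => ->; rewrite ?orbT.
have adjE y z : path_adj [:: v, a & s ++ [:: u, d & r]] y z =
    path_adj [:: v, a & rcons s u] y z || path_adj [:: u, d & r] y z.
  exact: (path_adj_cat [:: v, a & s]).
have inG y z : edge C y z -> edge G y z by move=> e; rewrite eG e orbT.
have locC y z : y \in verts C -> y != v -> y != u -> edge G y z -> edge C y z.
  move=> yC yv yu; rewrite eG => /or3P[/edge_mem/andP[yF _]|//|/edge_mem/andP[yH _]].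
    by rewrite (shared_vertex FC yF yC) eqxx in yv.
  by rewrite (shared_vertex HC yH yC) eqxx in yu.
have van1 : vanishes x [set y in a :: rcons s u].
  apply: (chain_force patternA (a := v)) => //.
  - move: us; rewrite -[[:: v, a & _ ++ _]]/([:: v, a & s] ++ [:: u, d & r]).
    by rewrite -cat_rcons cat_uniq => /andP[].
  - by move=> y z e; apply: inG; rewrite eC adjE e.
  - move=> y z; have -> : belast a (rcons s u) = a :: s.
      by elim: (s) (a) => //= h q IH c; rewrite IH.
    move=> yas; have yv := notv y (or_introl yas).
    have yu : y != u.
      by apply/eqP => yu; apply: (disj y) => //; rewrite yu mem_head.
    have yb : (y == b) = false.
      apply/eqP => yb; apply: (disj y) => //.
      by rewrite yb -lastr in_cons mem_last orbT.
    move=> /(locC _ _ (memC _ (or_introl yas)) yv yu).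
    rewrite eC adjE yb (negPf yv) andbF orbF /= orbF => /orP[//|/path_adj_mem/andP[yudr _]].
    by case: (disj y).
have xu : x 0 u = 0 by apply: van1; rewrite inE in_cons mem_rcons mem_head orbT.
split=> // [xd|xH].
  have van2 : vanishes x [set y in d :: r].
    apply: (chain_force patternA (a := u)) => //.
    - by move=> y z e; apply: inG; rewrite eC adjE e orbT.
    - move=> y z ydr.
      have ymem : y \in d :: r by apply: mem_belast.
      have yudr : y \in [:: u, d & r] by rewrite in_cons ymem orbT.
      have yv := notv y (or_intror yudr).
      have yu : y != u by apply: contraTneq uas => <-; rewrite cons_uniq ymem.
      have yb : (y == b) = false.
        apply: contraTF uas => /eqP yb.
        by rewrite cons_uniq lastI rcons_uniq lastr -yb ydr andbF.
      move=> /(locC _ _ (memC _ (or_intror yudr)) yv yu).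
      rewrite eC adjE yb (negPf yv) andbF orbF /= orbF => /orP[|//].
      case/path_adj_mem/andP; rewrite in_cons (negPf yv) /= -[a :: _]/(rcons (a :: s) u).
      rewrite mem_rcons in_cons (negPf yu) /= => yas _.
      by case: (disj y).
  move=> y; rewrite vCE in_cons mem_cat => /or3P[/eqP->//|yas|].
    by apply: van1; rewrite inE -[a :: _]/(rcons (a :: s) u) mem_rcons in_cons yas orbT.
  by rewrite in_cons => /orP[/eqP->//|ydr]; apply: van2; rewrite inE.
apply: (@force _ _ G A patternA x u) => //.
  by apply: inG; rewrite eC adjE path_adj_head // eqxx orbT.
move=> z; rewrite eG => /or3P[/edge_mem/andP[uF]|uz zd|uz _]; last exact: xH.
  have uH : u \in verts H by move/setP/(_ u): HC; rewrite !inE eqxx => /andP[].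
  by move/disjoint_setI0/setP/(_ u): dFH; rewrite !inE uF uH.
move: uz; rewrite eC adjE path_adj_head // (negPf zd) orbF (eq_sym u v) (negPf vu).
have -> : (u == b) = false.
  apply: contraTF uas => /eqP ub; rewrite cons_uniq negb_and.
  by rewrite ub -lastr mem_last.
rewrite andbF !orbF => /path_adj_mem/andP[_].
by rewrite in_cons => /orP[/eqP->//|zin]; apply: van1; rewrite inE.
Qed.

End PulsarForcing.

(** * Constraints on the inertia of a pulsar *)

Section PulsarLowerBound.
Variables (R : realType) (n : nat) (G : sgraph 'I_n) (A : 'M[R]_n).
Hypothesis patternA : forall i j, i != j -> (A i j != 0) = edge G i j.
Hypothesis symA : A^T = A.
Hypothesis vertsG : verts G = [set: 'I_n].
Implicit Types (x w : 'rV[R]_n) (Z : {set 'I_n}) (F H B P C S : sgraph 'I_n).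

Lemma dual_vertex_zero w c v x :
  c != 0 -> w *m A = c *: delta_mx 0 v -> x *m A = 0 -> x 0 v = 0.
Proof.
move=> c0 wA xA; have : w *m A *m x^T = 0.
  by rewrite -mulmxA -[A]symA -trmx_mul xA trmx0 mulmx0.
rewrite wA -scalemxAl -rowE => /matrixP/(_ 0 0); rewrite !mxE => /eqP.
by rewrite mulf_eq0 (negPf c0) => /eqP.
Qed.

(** The vector w is isotropic but not in the kernel of A. *)
Lemma dual_vertex_inertia w c v :
  c != 0 -> w *m A = c *: delta_mx 0 v -> w 0 v = 0 ->
  (0 < pos_inertia A)%N /\ (0 < neg_inertia A)%N.
Proof.
move=> c0 wA wv; have WAW : w *m A *m w^T = 0.
  by rewrite wA -scalemxAl -rowE; apply/rowP=> i; rewrite ord1 !mxE wv mulr0.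
have := isotropic_inertia_lb symA WAW; rewrite wA.
by rewrite mxrank_scale_nz // mxrank_delta.
Qed.

Lemma dual_vertices_inertia w1 c1 v1 w2 c2 v2 :
  c1 != 0 -> w1 *m A = c1 *: delta_mx 0 v1 -> w1 0 v1 = 0 -> w1 0 v2 = 0 ->
  c2 != 0 -> w2 *m A = c2 *: delta_mx 0 v2 -> w2 0 v1 = 0 -> w2 0 v2 = 0 ->
  v1 != v2 -> (1 < pos_inertia A)%N /\ (1 < neg_inertia A)%N.
Proof.
move=> c10 w1A w11 w12 c20 w2A w21 w22 v12.
pose W := col_mx w1 w2.
have WA : W *m A = col_mx (c1 *: delta_mx 0 v1) (c2 *: delta_mx 0 v2).
  by rewrite mul_col_mx w1A w2A.
have coord (w : 'rV[R]_n) c v : (c *: delta_mx 0 v : 'rV_n) *m w^T = (c * w 0 v)%:M.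
  by rewrite -scalemxAl -rowE; apply/rowP=> i; rewrite ord1 !mxE eqxx.
have WAW : W *m A *m W^T = 0.
  rewrite WA tr_col_mx mul_col_row !coord w11 w12 w21 w22 !mulr0.
  by rewrite !raddf0 block_mx0.
have rkWA : row_free (W *m A).
  apply: inj_row_free => a; rewrite WA -[a]hsubmxK mul_row_col => aWA.
  have coef i : lsubmx a 0 0 * c1 * (v1 == i)%:R + rsubmx a 0 0 * c2 * (v2 == i)%:R = 0.
    move/rowP/(_ i): aWA; rewrite !mxE !big_ord1 !mxE eqxx /=.
    by rewrite !mulrA !(eq_sym i).
  have a1 : lsubmx a 0 0 = 0.
    move: (coef v1); rewrite eqxx eq_sym (negPf v12) mulr0 addr0 mulr1 => /eqP.
    by rewrite mulf_eq0 (negPf c10) orbF => /eqP.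
  have a2 : rsubmx a 0 0 = 0.
    move: (coef v2); rewrite eqxx (negPf v12) mulr0 add0r mulr1 => /eqP.
    by rewrite mulf_eq0 (negPf c20) orbF => /eqP.
  have -> : lsubmx a = 0 by apply/rowP=> i; rewrite ord1 a1 mxE.
  have -> : rsubmx a = 0 by apply/rowP=> i; rewrite ord1 a2 mxE.
  by rewrite row_mx0.
by have := isotropic_inertia_lb symA WAW; rewrite (eqP rkWA).
Qed.

Lemma eq0_of_vanishes F C H x : verts G = verts F :|: verts C :|: verts H ->
  vanishes x (verts F) -> vanishes x (verts C) -> vanishes x (verts H) -> x = 0.
Proof.
rewrite vertsG => vG xF xC xH; apply/rowP=> y; rewrite mxE.
have : y \in [set: 'I_n] by rewrite inE.
by rewrite vG !inE -orbA => /or3P[/xF|/xC|/xH].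
Qed.

(** What is needed to apply row v: its neighbors outside the first supernova
    lie on the connecting cycle. *)
Lemma vanishes_hub al1 be1 al2 be2 F C H v u x y :
  pulsar_parts al1 be1 al2 be2 F C H v u G ->
  vanishes x (verts C) -> edge G v y ->
  (edge F v y -> x 0 y = 0) -> x 0 y = 0.
Proof.
case=> _ [dFH FC HC vG eG] xC; rewrite eG => /or3P[vy ->//|/edge_mem/andP[_ /xC]//|].
case/edge_mem/andP=> vH _.
have vF : v \in verts F by move/setP/(_ v): FC; rewrite !inE eqxx => /andP[].
by move/disjoint_setI0/setP/(_ v): dFH; rewrite !inE vF vH.
Qed.

Local Notation p := (pos_inertia A).
Local Notation m := (neg_inertia A).

Lemma pulsar_singular_nonsingular al1 be1 al2 be2 F C H v u Z0 Z1 Z2 q0 w c :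
  pulsar_parts al1 be1 al2 be2 F C H v u G ->
  (#|Z1| <= al1)%N -> (#|Z0| < be1)%N -> edge G v q0 ->
  (forall x, x *m A = 0 -> x 0 v = 0 -> vanishes x Z1 -> vanishes x Z0 ->
      (forall y, edge F v y -> y != q0 -> x 0 y = 0) /\
      (x 0 q0 = 0 -> vanishes x (verts F))) ->
  c != 0 -> w *m A = c *: delta_mx 0 v -> w 0 v = 0 ->
  (#|Z2| <= al2)%N ->
  (forall x, x *m A = 0 -> x 0 u = 0 -> vanishes x Z2 -> vanishes x (verts H)) ->
  [/\ (0 < p)%N, (0 < m)%N & (n <= p + m + al1 + al2 + be1)%N].
Proof.
move=> pG cZ1 cZ0 vw0 forceF c0 wA wv cZ2 forceH.
have [p0 m0] := dual_vertex_inertia c0 wA wv; split=> //.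
have [a [d conn]] := connecting_cycle_forcing patternA pG.
have corank := @corank_forcing _ _ A (Z1 :|: Z0 :|: Z2 :|: [set a]).
have : (n <= \rank A + #|Z1 :|: Z0 :|: Z2 :|: [set a]|)%N.
  apply: corank => x xA /vanishesU[/vanishesU[/vanishesU[xZ1 xZ0] xZ2] /vanishes1 xa].
  have xv := dual_vertex_zero c0 wA xA.
  have [xu dC xd] := conn x xA xv xa.
  have xH := forceH x xA xu xZ2.
  have xC : vanishes x (verts C).
    by apply/dC/xd => y /edge_mem/andP[_]; apply: xH.
  have [xF xw] := forceF x xA xv xZ1 xZ0.
  have [_ [_ _ _ vG _]] := pG.
  apply: (eq0_of_vanishes vG) => //; apply: xw.
  apply: (@force _ _ G A patternA x v) => //; first by rewrite xA mxE.
  by move=> y vy yw; apply: (vanishes_hub pG) => // /xF; apply.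
rewrite -(inertia_rank symA) => /leq_trans; apply.
have := (leq_card_setU (Z1 :|: Z0 :|: Z2) [set a],
         leq_card_setU (Z1 :|: Z0) Z2, leq_card_setU Z1 Z0).
rewrite cards1; case=> -[[h1 _] [h2 _]] [h3 _].
lia.
Qed.

(** The cases are whether a pendant path of v, and one of u, is singular. *)
Lemma pulsar_inertia_bound al1 be1 al2 be2 F C H v u :
  pulsar_parts al1 be1 al2 be2 F C H v u G ->
  [\/ (n <= p + m + al1 + al2 + 2)%N,
      [/\ (0 < p)%N, (0 < m)%N & (n <= p + m + al1 + al2 + be1)%N],
      [/\ (0 < p)%N, (0 < m)%N & (n <= p + m + al1 + al2 + be2)%N] |
      [/\ (1 < p)%N, (1 < m)%N & (n <= p + m + al1 + al2 + be1 + be2)%N]].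
Proof.
move=> pG; have pG' := pulsar_parts_sym pG.
have hF := pulsar_parts_hangs pG; have hH := pulsar_parts_hangs pG'.
have [[sF sH _ vu _] [dFH FC HC vG _]] := pG.
have [w1 [Z1 [Z1' [cZ1 cZ1' vw1 force1 dich1]]]] := supernova_forcing patternA sF hF.
have [w2 [Z2 [Z2' [cZ2 cZ2' uw2 force2 dich2]]]] := supernova_forcing patternA sH hH.
have [a [d conn]] := connecting_cycle_forcing patternA pG.
have rkA := inertia_rank symA.
case: dich1 => [ns1|[x1 [c1 [c10 x1A x1v x1F]]]];
  case: dich2 => [ns2|[x2 [c2 [c20 x2A x2u x2H]]]].
- constructor 1.
  have : (n <= \rank A + #|Z1 :|: Z2 :|: [set v] :|: [set a]|)%N.
    apply: corank_forcing => x xA.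
    case/vanishesU=> /vanishesU[/vanishesU[xZ1 xZ2] /vanishes1 xv] /vanishes1 xa.
    have [xu dC xd] := conn x xA xv xa; have xH := ns2 x xA xu xZ2.
    have xC : vanishes x (verts C).
      by apply/dC/xd => y /edge_mem/andP[_]; apply: xH.
    by apply: (eq0_of_vanishes vG) => //; apply: ns1.
  rewrite -rkA => /leq_trans; apply.
  have := (leq_card_setU (Z1 :|: Z2 :|: [set v]) [set a],
           leq_card_setU (Z1 :|: Z2) [set v], leq_card_setU Z1 Z2).
  rewrite !cards1; case=> -[[h1 _] [h2 _]] [h3 _].
  lia.
- constructor 3; rewrite -[(p + m + al1 + al2)%N]addnAC.
  exact: (pulsar_singular_nonsingular pG' cZ2 cZ2' uw2 force2 c20 x2A x2u cZ1 ns1).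
- constructor 2.
  exact: (pulsar_singular_nonsingular pG cZ1 cZ1' vw1 force1 c10 x1A x1v cZ2 ns2).
constructor 4.
have vF : v \in verts F by move/setP/(_ v): FC; rewrite !inE eqxx => /andP[].
have uH : u \in verts H by move/setP/(_ u): HC; rewrite !inE eqxx => /andP[].
have x1u : x1 0 u = 0.
  apply: x1F; apply/negP => uF.
  by move/disjoint_setI0/setP/(_ u): dFH; rewrite !inE uF uH.
have x2v : x2 0 v = 0.
  apply: x2H; apply/negP => vH.
  by move/disjoint_setI0/setP/(_ v): dFH; rewrite !inE vF vH.
have [p2 m2] := dual_vertices_inertia c10 x1A x1v x1u c20 x2A x2v x2u vu.
split=> //.
have : (n <= \rank A + #|Z1 :|: Z1' :|: Z2 :|: Z2' :|: [set a] :|: [set d]|)%N.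
  apply: corank_forcing => x xA.
  case/vanishesU=> /vanishesU[/vanishesU[/vanishesU[/vanishesU[xZ1 xZ1'] xZ2] xZ2']].
  move=> /vanishes1 xa /vanishes1 xd.
  have xv := dual_vertex_zero c10 x1A xA; have xu := dual_vertex_zero c20 x2A xA.
  have [_ /(_ xd) xC _] := conn x xA xv xa.
  have [xF xw1] := force1 x xA xv xZ1 xZ1'.
  have [xH xw2] := force2 x xA xu xZ2 xZ2'.
  have rows y : (x *m A) 0 y = 0 by rewrite xA mxE.
  apply: (eq0_of_vanishes vG) => //.
    apply/xw1/(force patternA (rows v)) => // y vy yw.
    by apply: (vanishes_hub pG) => // /xF; apply.
  apply/xw2/(force patternA (rows u)) => // y uy yw.
  by apply: (vanishes_hub pG') => // /xH; apply.
rewrite -rkA => /leq_trans; apply.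
have := (leq_card_setU (Z1 :|: Z1' :|: Z2 :|: Z2' :|: [set a]) [set d],
         leq_card_setU (Z1 :|: Z1' :|: Z2 :|: Z2') [set a],
         leq_card_setU (Z1 :|: Z1' :|: Z2) Z2', leq_card_setU (Z1 :|: Z1') Z2,
         leq_card_setU Z1 Z1').
rewrite !cards1; case=> -[[[[h1 _] [h2 _]] [h3 _]] [h4 _]] [h5 _].
lia.
Qed.

End PulsarLowerBound.

(** * Sums of signed rank-one matrices realizing a graph *)

Section Realization.
Variables (R : realType) (n : nat).
Implicit Types (x y z f g : 'rV[R]_n) (B : seq 'rV[R]_n) (X Y : {set 'I_n}).
Implicit Types (L : seq (bool * 'rV[R]_n)) (W : seq 'I_n) (E : rel 'I_n).

Local Notation e_ i := (delta_mx 0 i : 'rV[R]_n).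

Definition supported x X := forall i, i \notin X -> x 0 i = 0.

Lemma supportedS x X Y : X \subset Y -> supported x X -> supported x Y.
Proof. by move=> /subsetP XY xX i iY; apply: xX; apply: contra iY; apply: XY. Qed.

Lemma supported_delta i X : i \in X -> supported (e_ i) X.
Proof.
by move=> iX j jX; rewrite mxE eqxx /=; case: eqVneq jX => // ->; rewrite iX.
Qed.

Lemma supported_span B x X :
  {in B, forall y, supported y X} -> x \in <<B>>%VS -> supported x X.
Proof.
move=> BX xB i iX; rewrite (coord_span (X := in_tuple B) xB) summxE big1 // => k _.
by rewrite mxE BX ?mulr0 //; apply: mem_nth.
Qed.

Lemma span_supported W x : supported x [set i in W] -> x \in <<[seq e_ i | i <- W]>>%VS.
Proof.
move=> xW; rewrite (row_sum_delta x); apply: memv_suml => i _.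
have [iW|iW] := boolP (i \in W); last by rewrite xW ?inE // scale0r mem0v.
by apply/memvZ/memv_span/map_f.
Qed.

(** The vectors f and g are independent of B by their coordinate a, and of each
    other modulo B because f - g is not in the span of B. *)
Lemma free_exchange a f g B :
  free B -> {in B, forall x, x 0 a = 0} -> f 0 a = 1 -> g 0 a = 1 ->
  f - g \notin <<B>>%VS -> free [:: f, g & B].
Proof.
move=> fB Ba fa ga fgB; rewrite !free_cons fB andbT.
have Ba' x : x \in <<B>>%VS -> x 0 a = 0.
  move=> xB; apply: (@supported_span B x [set~ a]) => //; last by rewrite !inE eqxx.
  by move=> y yB i; rewrite !inE negbK => /eqP->; apply: Ba.
apply/andP; split; last first.
  by apply/negP => /Ba'/eqP; rewrite ga oner_eq0.
rewrite span_cons; apply: contra fgB => /memv_addP[_ /vlineP[c ->] [y yB fE]].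
have := congr1 (fun x => x 0 a) fE; rewrite !mxE fa ga Ba' // addr0 mulr1 => c1.
by rewrite fE -c1 scale1r addrAC subrr add0r.
Qed.

Lemma signed_form_cons p L :
  signed_form (p :: L) = (-1) ^+ p.1 *: (p.2^T *m p.2) + signed_form L.
Proof. by rewrite /signed_form big_cons. Qed.

Lemma signed_form_cat L1 L2 :
  signed_form (L1 ++ L2) = signed_form L1 + signed_form L2.
Proof. by rewrite /signed_form big_cat. Qed.

Lemma rank_oneE x i j : (x^T *m x) i j = x 0 i * x 0 j.
Proof. by rewrite mxE big_ord1 !mxE. Qed.

Lemma signed_form_supported L X i j :
  {in L, forall p, supported p.2 X} -> ~~ ((i \in X) && (j \in X)) ->
  signed_form L i j = 0.
Proof.
move=> LX ijX; rewrite /signed_form summxE big_seq big1 // => p pL.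
rewrite mxE rank_oneE; move: ijX; rewrite negb_and => /orP[/(LX p pL)|/(LX p pL)] ->.
  by rewrite mul0r mulr0.
by rewrite !mulr0.
Qed.

Definition basis_vectors W L := [seq e_ i | i <- W] ++ [seq p.2 | p <- L].

(** The matrix of the graph E on X is a sum of r positive and s negative rank-one
    terms supported in X whose vectors are independent modulo the basis
    vectors of the roots W. *)
Definition realizes X W E r s := exists L,
  [/\ {in L, forall p, supported p.2 X},
      (forall i j, i != j -> (signed_form L i j != 0) = E i j),
      free (basis_vectors W L),
      count (fun p => ~~ p.1) L = r & count (fun p => p.1) L = s].

Definition thin W := (size W <= 1)%N.

(** The matrices add up without interference off the diagonal, as the pieces
    share at most one vertex.  For independence, a dependency between the two
    families would be a vector supported on W2, which the independence modulo W2
    of the second family excludes. *)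
Lemma realizes_union X1 W1 E1 r1 s1 X2 W2 E2 r2 s2 :
  realizes X1 W1 E1 r1 s1 -> realizes X2 W2 E2 r2 s2 ->
  {subset W1 <= X1} -> X1 :&: X2 = [set i in W2] -> thin W2 ->
  realizes (X1 :|: X2) W1 (fun i j => E1 i j || E2 i j) (r1 + r2) (s1 + s2).
Proof.
move=> [L1 [sup1 pat1 free1 <- <-]] [L2 [sup2 pat2 free2 <- <-]] W1X X12 thinW.
have sup p : p \in L1 ++ L2 -> supported p.2 (X1 :|: X2).
  rewrite mem_cat => /orP[/sup1|/sup2]; apply: supportedS.
    exact: subsetUl.
  exact: subsetUr.
exists (L1 ++ L2); split=> //; last 2 [by rewrite count_cat]; last by rewrite count_cat.
  move=> i j ij; rewrite signed_form_cat mxE -pat1 // -pat2 //.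
  have [zero1|nz1] := eqVneq (signed_form L1 i j) 0; first by rewrite zero1 add0r.
  have -> : signed_form L2 i j = 0; last by rewrite addr0 eqxx orbF nz1.
  apply: (signed_form_supported sup2); apply/negP => /andP[i2 j2].
  have /andP[i1 j1] : (i \in X1) && (j \in X1).
    by apply: contraNT nz1 => /(signed_form_supported sup1)->.
  have : i \in X1 :&: X2 by rewrite inE i1.
  have : j \in X1 :&: X2 by rewrite inE j1.
  move: thinW ij; rewrite X12 !inE; case: (W2) => [|w [|]] //= _ ij.
  by rewrite !inE => /eqP jw /eqP iw; rewrite iw jw eqxx in ij.
rewrite /basis_vectors map_cat catA cat_free free1 (catr_free free2) /=.
apply/directv_addP/eqP; rewrite -subv0; apply/subvP => y; rewrite memv_cap.
case/andP=> y1 y2.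
move: free2; rewrite cat_free => /and3P[_ _ /directv_addP <-].
rewrite memv_cap y2 andbT; apply: span_supported => i iW.
have {iW} : i \notin X1 :&: X2 by rewrite X12.
rewrite inE negb_and => /orP[i1|i2].
  apply: supported_span y1 _ i1 => x; rewrite mem_cat => /orP[/mapP[w wW ->]|/mapP[p pL ->]].
    by apply: supported_delta; apply: W1X.
  exact: sup1.
by apply: supported_span y2 _ i2 => x /mapP[p pL ->]; apply: sup2.
Qed.

(** The vector e_d changes only a diagonal entry. *)
Lemma realizes_unroot X d W E r s :
  realizes X (d :: W) E r s -> d \in X ->
  [/\ realizes X W E r s, realizes X W E r.+1 s & realizes X W E r s.+1].
Proof.
move=> [L [sup pat freeL cr cs]] dX.
have add b : realizes X W E (~~ b + r) (b + s).
  exists ((b, e_ d) :: L); split=> /=; rewrite ?cr ?cs //.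
  - by move=> p; rewrite inE => /orP[/eqP->|/sup//]; apply: supported_delta.
  - move=> i j ij; rewrite signed_form_cons mxE [X in X + _]mxE rank_oneE.
    rewrite ![delta_mx _ _ _ _]mxE eqxx /= -pat //.
    case: (eqVneq i d) ij => [->|_] ij; last by rewrite mul0r mulr0 add0r.
    by rewrite (eq_sym j) (negPf ij) !mulr0 add0r.
  - rewrite (perm_free (Y := basis_vectors (d :: W) L)) //.
    by rewrite /basis_vectors /= perm_catC /= perm_cons perm_catC.
split; [|exact: (add false)|exact: (add true)].
exists L; split=> //; move: freeL; rewrite /basis_vectors /= -cat1s.
exact: catr_free.
Qed.

(** The difference (e_u + z)^T (e_u + z) - (e_u - z)^T (e_u - z) is
    2 (e_u^T z + z^T e_u): it writes row and column u and changes nothing else.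
    The coefficient of w in z is free, and since e_w is independent of the other
    vectors, one of two choices keeps z independent of them. *)
Lemma realizes_hyperbolic X u w W E' E r s :
  realizes X (w :: W) E' r s -> u \notin X -> {subset W <= X} -> symmetric E ->
  E u w -> (forall j, E u j -> j \in X) ->
  (forall i j, i != u -> j != u -> E i j = E' i j) ->
  realizes (u |: X) W E r.+1 s.+1.
Proof.
move=> [L [sup pat freeL <- <-]] uX WX symE uw EX EE'.
set B := basis_vectors W L; have {}freeL : free (e_ w :: B) := freeL.
move: freeL; rewrite free_cons => /andP[ewB freeB].
pose zc (c : R) := \row_j (if E u j then (if j == w then c else 1) else 0).
have [c [c0 zB]] : exists c, c != 0 /\ zc c \notin <<B>>%VS.
  have [z1|z1] := boolP (zc 1 \in <<B>>%VS); last by exists 1; rewrite oner_neq0.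
  exists 2; rewrite pnatr_eq0; split=> //; apply: contra ewB => z2.
  have -> : e_ w = zc 2 - zc 1; last exact: rpredB.
  apply/rowP=> j; rewrite !mxE eqxx /=; case: eqVneq => [->|_].
    by rewrite uw mulr1n; ring.
  by case: (E u j); rewrite subrr.
have [z [zu znz {}zB]] :
    exists z, [/\ z 0 u = 0, forall j, (z 0 j != 0) = E u j & z \notin <<B>>%VS].
  exists (zc c); split=> // [|j]; rewrite mxE.
    by case: ifP => // /EX uX'; rewrite uX' in uX.
  case: (E u j); last by rewrite eqxx.
  by case: (j == w); rewrite ?c0 ?oner_neq0.
have euE j : (e_ u : 'rV[R]_n) 0 j = (j == u)%:R by rewrite mxE eqxx.
have zX : supported z (u |: X).
  move=> j jX; apply/eqP; rewrite -[_ == _]negbK znz; apply: contra jX => /EX.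
  by rewrite !inE orbC => ->.
have supu : supported (e_ u) (u |: X) by apply: supported_delta; rewrite setU11.
exists [:: (false, e_ u + z), (true, e_ u - z) & L]; split=> //.
- move=> p; rewrite !inE => /or3P[/eqP->|/eqP->|/sup] /=.
  + by move=> j jX; rewrite mxE supu // zX // addr0.
  + by move=> j jX; rewrite !mxE -euE supu // zX // subr0.
  + by apply: supportedS; apply: subsetUr.
- move=> i j ij; rewrite !signed_form_cons /= expr0 expr1 scale1r scaleN1r.
  have -> : ((e_ u + z)^T *m (e_ u + z) + (- ((e_ u - z)^T *m (e_ u - z)) +
      signed_form L)) i j =
      2 * ((i == u)%:R * z 0 j + z 0 i * (j == u)%:R) + signed_form L i j.
    rewrite mxE [X in _ + X]mxE [X in _ + (X + _)]mxE !rank_oneE.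
    rewrite ![(_ + z) 0 _]mxE ![(_ - z) 0 _]mxE ![(- z) 0 _]mxE !euE; ring.
  have [iu|iu] := eqVneq i u.
    rewrite iu in ij *; rewrite (eq_sym j) (negPf ij) mulr0 addr0 mul1r.
    rewrite (signed_form_supported sup) ?(negPf uX) // addr0.
    by rewrite mulf_eq0 pnatr_eq0 /= znz.
  have [ju|ju] := eqVneq j u; last first.
    by rewrite mul0r mulr0 addr0 mulr0 add0r pat // EE'.
  rewrite ju mul0r add0r mulr1 (signed_form_supported sup) ?(negPf uX) ?andbF //.
  by rewrite addr0 mulf_eq0 pnatr_eq0 /= znz symE.
- rewrite (perm_free (Y := [:: e_ u + z, e_ u - z & B])); last first.
    by rewrite /basis_vectors /= perm_catC /= !perm_cons perm_catC.
  apply: (@free_exchange u) => //.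
  + move=> x; rewrite mem_cat => /orP[/mapP[i iW ->]|/mapP[p /sup pX ->]]; last exact: pX.
    by rewrite mxE eqxx /=; case: eqP => // ui; rewrite ui WX in uX.
  + by rewrite mxE zu euE eqxx addr0.
  + by rewrite !mxE zu !eqxx subr0.
  + have -> : e_ u + z - (e_ u - z) = 2 *: z.
      by rewrite opprB addrC addrA subrK scaler_nat mulr2n.
    by rewrite rpredZeq pnatr_eq0.
Qed.

End Realization.

(** * Gluing realizations *)

Section Flexible.
Variables (R : realType) (n : nat).
Implicit Types (X Y : {set 'I_n}) (W : seq 'I_n) (E : rel 'I_n) (u v : 'I_n).

Local Notation e_ i := (delta_mx 0 i : 'rV[R]_n).
Local Notation realizes := (@realizes R n).

Definition off_diagonal_eq E E' := forall i j, i != j -> E i j = E' i j.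

Lemma realizes_ext X W E E' r s :
  off_diagonal_eq E E' -> realizes X W E r s -> realizes X W E' r s.
Proof.
move=> EE' [L [sup pat freeL cr cs]]; exists L; split=> // i j ij.
by rewrite pat // EE'.
Qed.

(** All inertias (r, s) with r, s >= k and of rank between N - a and N can be
    realized, where N = #|X| - size W is the largest number of vectors supported
    in X that can be independent modulo the roots W.  The slack a counts the
    vectors that may be left out; the bound a + 2 k <= N is what allows a
    pair (r, s) to be split between two pieces. *)
Definition flexible X W E k a :=
  [/\ {subset W <= X}, uniq W, (size W + a + k.*2 <= #|X|)%N &
      forall r s, (k <= r)%N -> (k <= s)%N ->
        (#|X| <= r + s + size W + a)%N -> (r + s + size W <= #|X|)%N ->
        realizes X W E r s].

Lemma flexible_ext X W E E' k a :
  off_diagonal_eq E E' -> flexible X W E k a -> flexible X W E' k a.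
Proof.
move=> EE' [WX uW bnd real]; split=> // r s kr ks lo hi.
by apply: realizes_ext EE' _; apply: real.
Qed.

Lemma card_set_uniq W : uniq W -> #|[set i in W]| = size W.
Proof. by move=> uW; rewrite cardsE; apply/card_uniqP. Qed.

Lemma flexible_union X1 W1 E1 a1 X2 W2 E2 k a2 :
  flexible X1 W1 E1 0 a1 -> flexible X2 W2 E2 k a2 ->
  X1 :&: X2 = [set i in W2] -> thin W2 ->
  flexible (X1 :|: X2) W1 (fun i j => E1 i j || E2 i j) k (a1 + a2).
Proof.
move=> [W1X uW1 bnd1 real1] [W2X uW2 bnd2 real2] X12 thinW.
have cardU : (#|X1 :|: X2| + size W2 = #|X1| + #|X2|)%N.
  by rewrite -cardsUI X12 card_set_uniq.
split=> //; first by move=> w /W1X; rewrite inE => ->.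
  by lia.
move=> r s kr ks lo hi.
(* t2: rank spent on the second piece; r2: its positive part *)
pose t2 := maxn (#|X2| - size W2 - a2) (r + s + size W1 - #|X1|).
pose r2 := maxn k (t2 - s).
have -> : r = (r - r2 + r2)%N by rewrite /r2 /t2; lia.
have -> : s = (s - (t2 - r2) + (t2 - r2))%N by rewrite /r2 /t2; lia.
by apply: (realizes_union (W2 := W2)) => //; [apply: real1|apply: real2];
  rewrite /r2 /t2; lia.
Qed.

Lemma flexible_unroot X (d : 'I_n) W E k a :
  flexible X (d :: W) E k a -> flexible X W E k a.+1.
Proof.
case=> WX /andP[_ uW] bnd real; have sW : size (d :: W) = (size W).+1 by [].
have dX : d \in X by apply: WX; rewrite mem_head.
split=> //; [by move=> w wW; apply: WX; rewrite in_cons wW orbT|by lia|].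
move=> r s kr ks lo hi.
have [lt_hi|eq_hi] : (r + s + size W < #|X|)%N \/ (r + s + size W = #|X|)%N by lia.
  have rls : realizes X (d :: W) E r s by apply: real; lia.
  by have [] := realizes_unroot rls dX.
have [kr'|ks'] : (k < r)%N \/ (k < s)%N by lia.
  have rls : realizes X (d :: W) E r.-1 s by apply: real; lia.
  have [_ + _] := realizes_unroot rls dX; by rewrite prednK //; lia.
have rls : realizes X (d :: W) E r s.-1 by apply: real; lia.
have [_ _] := realizes_unroot rls dX; by rewrite prednK //; lia.
Qed.

Lemma flexible_hyperbolic X u (w : 'I_n) W E' E k a :
  flexible X (w :: W) E' k a -> u \notin X -> symmetric E ->
  E u w -> (forall j, E u j -> j \in X) ->
  (forall i j, i != u -> j != u -> E i j = E' i j) ->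
  flexible (u |: X) W E k.+1 a.
Proof.
move=> [WX /andP[_ uW] bnd real] uX symE uw EX EE'.
have sW : size (w :: W) = (size W).+1 by [].
have WX' : {subset W <= X} by move=> i iW; apply: WX; rewrite in_cons iW orbT.
have cX : #|u |: X| = #|X|.+1 by rewrite cardsU1 uX.
split=> //; [by move=> i /WX' iX; rewrite inE iX orbT|by rewrite cX; lia|].
move=> r s kr ks; rewrite cX => lo hi.
rewrite -(ltn_predK kr) -(ltn_predK ks).
by apply: (realizes_hyperbolic (w := w) (E' := E')) => //; apply: real; lia.
Qed.

Lemma realizes_empty W : uniq W -> realizes [set i in W] W (fun _ _ => false) 0 0.
Proof.
move=> uW; exists [::]; split=> //.
  by move=> i j _; rewrite /signed_form big_nil mxE eqxx.
rewrite /basis_vectors cats0; elim: W uW => [|w W IHW] /=; first by rewrite nil_free.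
case/andP=> wW uW; rewrite free_cons IHW // andbT.
apply/negP => /supported_span sup.
have /eqP : e_ w 0 w = 0.
  apply: (sup [set~ w]); last by rewrite !inE eqxx.
  move=> _ /mapP[i iW ->]; apply: supported_delta; rewrite !inE.
  by apply: contraNneq wW => <-.
by rewrite mxE !eqxx oner_eq0.
Qed.

Lemma flexible_empty W : uniq W -> flexible [set i in W] W (fun _ _ => false) 0 0.
Proof.
move=> uW; have cW := card_set_uniq uW.
split=> //; [by move=> i; rewrite inE|by rewrite cW; lia|].
move=> r s _ _; rewrite cW => lo hi.
have -> : r = 0%N by lia.
have -> : s = 0%N by lia.
exact: realizes_empty.
Qed.

Lemma flexible_edge u v : u != v ->
  flexible [set u; v] [:: u] (path_adj [:: u; v]) 0 0.
Proof.
move=> uv; have cX : #|[set u; v]| = 2 by rewrite cards2 uv.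
split; rewrite ?cX //; first by move=> i; rewrite !inE => ->.
move=> r s _ _ /= lo hi.
exists [:: ((0 < s)%N, e_ u - e_ v)]; split=> /=.
- move=> p; rewrite inE => /eqP-> /= i; rewrite !inE negb_or !mxE eqxx /=.
  by case/andP=> /negPf-> /negPf->; rewrite subrr.
- move=> i j ij; rewrite signed_form_cons /signed_form big_nil addr0 mxE rank_oneE.
  rewrite mulf_eq0 signr_eq0 /= !mxE eqxx /= path_adj_cons.
  have [iu|iu] := eqVneq i u.
    rewrite iu eq_sym in ij; rewrite iu (negPf uv) (negPf ij) subr0 mul1r.
    by case: (j == v) => /=; rewrite ?sub0r ?oppr_eq0 ?oner_eq0 ?subrr ?eqxx ?andbF.
  have [iv|iv] := eqVneq i v; last by rewrite subrr mul0r eqxx !andbF.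
  rewrite sub0r mulN1r oppr_eq0; rewrite iv eq_sym in ij; rewrite (negPf ij) subr0.
  by case: (j == u); rewrite ?oner_eq0 ?eqxx.
- rewrite /basis_vectors /= free_cons seq1_free span_seq1; apply/andP; split.
    apply/vlineP=> -[c /rowP E]; have := E v; have := E u.
    rewrite !mxE !eqxx (negPf uv) (eq_sym v) (negPf uv) /= subr0 sub0r mulr1 => <-.
    by rewrite mul1r => /eqP; rewrite eq_sym oppr_eq0 oner_eq0.
  apply/eqP => /rowP/(_ u)/eqP; rewrite !mxE !eqxx (negPf uv) /= subr0.
  by rewrite oner_eq0.
- by case: (ltnP 0 s) => hs /=; lia.
- by case: (ltnP 0 s) => hs /=; lia.
Qed.

Lemma flexible_path v s : uniq (v :: s) ->
  flexible [set i in v :: s] [:: v] (path_adj (v :: s)) 0 0.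
Proof.
elim: s v => [|w s IHs] v.
  move=> uv; apply: flexible_ext (flexible_empty uv) => i j ij.
  by rewrite /path_adj /=.
move=> us; have [vws uws] := andP us.
have vw : v != w by apply: contraNneq vws => ->; rewrite mem_head.
have := flexible_union (flexible_edge vw) (IHs w uws); rewrite addn0.
have -> : [set v; w] :|: [set i in w :: s] = [set i in [:: v, w & s]].
  by apply/setP=> i; rewrite !inE; case: (i == w); rewrite ?orbT ?orbF.
move=> H; apply: flexible_ext (H _ _) => //.
  by move=> i j _; rewrite !path_adj_cons [path_adj [:: w] _ _]/path_adj /= orbF -orbA.
apply/setP=> i; rewrite !inE; have [->|iv] := eqVneq i v.
  by rewrite (negPf vw) /=; apply/negbTE; rewrite in_cons negb_or in vws; case/andP: vws.
by case: (i == w).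
Qed.

End Flexible.

Section Fan.
Variables (R : realType) (n : nat).
Local Notation e_ i := (delta_mx 0 i : 'rV[R]_n).

(** The path t between the two neighbors of v gets the vectors
    e_i - e_j + eps e_v, i and j consecutive, with eps the sign of the term:
    the contribution of each to row v is e_i - e_j, and these telescope to
    entries 1 and -1 at the two ends of the path and 0 inside. *)
Lemma cycle_vectors (v a : 'I_n) (t : seq 'I_n) (r s : nat) :
  uniq [:: v, a & t] -> (r + s = size t)%N ->
  exists L : seq (bool * 'rV[R]_n),
  [/\ {in L, forall p, supported p.2 [set i in [:: v, a & t]]},
      (forall i j, i != v -> j != v -> i != j ->
         (signed_form L i j != 0) = path_adj (a :: t) i j),
      (forall j, j != v ->
         signed_form L v j = (j == a)%:R - (j == last a t)%:R),
      free (basis_vectors [:: a; v] L) &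
      (count (fun p => ~~ p.1) L = r) /\ (count (fun p => p.1) L = s)].
Proof.
elim: t a r s => [|b t IHt] a r s us rs.
  have [-> ->] : r = 0%N /\ s = 0%N by move: rs => /=; lia.
  have va : a != v by move: us; rewrite /= inE eq_sym andbT.
  exists [::]; split=> //.
  - by move=> i j _ _ _; rewrite /signed_form big_nil mxE eqxx.
  - by move=> j _; rewrite /signed_form big_nil mxE subrr.
  rewrite /basis_vectors /= free_cons seq1_free span_seq1; apply/andP; split.
    apply/vlineP=> -[c /rowP/(_ a)/eqP].
    by rewrite !mxE !eqxx (negPf va) mulr0 oner_eq0.
  by apply/eqP => /rowP/(_ v)/eqP; rewrite !mxE !eqxx oner_eq0.
have /andP[vN /andP[aN ubt]] := us.
have usb : uniq [:: v, b & t].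
  apply/andP; split; last exact: ubt.
  by apply: contra vN => vbt; rewrite in_cons vbt orbT.
have ab : a != b by apply: contraNneq aN => ->; rewrite mem_head.
have av : a != v by apply: contraNneq vN => ->; rewrite mem_head.
have vb : v != b by apply: contraNneq vN => ->; rewrite !in_cons eqxx orbT.
have abt : a \notin [:: v, b & t] by rewrite in_cons negb_or av.
pose neg := (r == 0)%N.
have rs' : (r - ~~ neg + (s - neg) = size t)%N.
  by move: rs; rewrite /neg; clear; case: r => [|r'] /=; lia.
have [L [sup pat fan freeL [cr cs]]] :=
  IHt b (r - ~~ neg)%N (s - neg)%N usb rs'.
pose eps : R := (-1) ^+ neg.
have eps2 : eps * eps = 1 by rewrite /eps -expr2 sqrr_sign.
pose x : 'rV[R]_n := e_ a - e_ b + eps *: e_ v.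
have xE j : x 0 j = (j == a)%:R - (j == b)%:R + eps * (j == v)%:R.
  by rewrite !mxE eqxx.
have La0 i : signed_form L a i = 0.
  by apply: (signed_form_supported sup); rewrite inE (negPf abt).
have Li0 i : signed_form L i a = 0.
  by apply: (signed_form_supported sup); rewrite !inE in abt *; rewrite (negPf abt) andbF.
exists ((neg, x) :: L); split.
- move=> p; rewrite inE => /orP[/eqP->|/sup]; last first.
    apply: supportedS; apply/subsetP => i; rewrite !inE.
    by case/or3P=> ->; rewrite ?orbT.
  move=> i; rewrite /= !inE !negb_or xE.
  by case/and4P=> /negPf-> /negPf-> /negPf-> _; rewrite mulr0 addr0 subrr.
- move=> i j iv jv ij; rewrite signed_form_cons mxE [X in X + _]mxE rank_oneE /= -/eps !xE.
  rewrite (negPf iv) (negPf jv) mulr0 !addr0 path_adj_cons -pat //.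
  have [ia|ia] := eqVneq i a.
    rewrite ia in ij *; rewrite La0 (negPf ab) (eq_sym j) (negPf ij) eqxx andbF !orbF /=.
    rewrite addr0 subr0 sub0r mul1r mulrN oppr_eq0 mulf_eq0 signr_eq0 /=.
    by case: (j == b); rewrite ?oner_eq0 ?eqxx.
  have [ja|ja] := eqVneq j a.
    rewrite ja Li0 (negPf ab) eqxx orbF subr0 mulr1 sub0r addr0 mulrN oppr_eq0.
    by rewrite mulf_eq0 signr_eq0 /=; case: (i == b); rewrite ?oner_eq0 ?eqxx.
  rewrite !sub0r /= mulrNN.
  have -> : (i == b)%:R * (j == b)%:R = 0 :> R; last by rewrite mulr0 add0r.
  have [ib|_] := eqVneq i b; last by rewrite mul0r.
  by rewrite ib eq_sym in ij; rewrite (negPf ij) mulr0.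
- move=> j jv; rewrite signed_form_cons mxE [X in X + _]mxE rank_oneE /= -/eps !xE fan //.
  rewrite eqxx (eq_sym v a) (negPf av) (negPf vb) (negPf jv) subrr add0r mulr1 mulr0 addr0.
  by rewrite mulrA eps2 mul1r addrA subrK.
- rewrite (perm_free (Y := [:: e_ a, x & e_ v :: [seq p.2 | p <- L]])); last first.
    by rewrite /basis_vectors /= perm_cons; apply/permP => q /=; rewrite addnCA.
  move: freeL; rewrite /basis_vectors [_ ++ _]/= free_cons => /andP[eb freeL].
  apply: (@free_exchange _ _ a) => //.
  + move=> y; rewrite inE => /orP[/eqP->|/mapP[p pL ->]].
      by rewrite mxE eqxx (negPf av).
    by apply: (sup p pL); rewrite inE.
  + by rewrite mxE !eqxx.
  + by rewrite xE eqxx (negPf ab) (negPf av) mulr0 subr0 addr0.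
  + have -> : e_ a - x = e_ b - eps *: e_ v.
      by rewrite /x opprD addrA opprB addrCA subrr addr0.
    apply: contra eb => eb; rewrite -[e_ b](subrK (eps *: e_ v)).
    by apply: rpredD => //; apply/memvZ/memv_span; rewrite mem_head.
by rewrite /= cr cs; move: rs; rewrite /neg; clear; case: r => [|r'] /=; lia.
Qed.

Lemma flexible_cycle (v : 'I_n) (s : seq 'I_n) (E : rel 'I_n) :
  (2 <= size s)%N -> uniq (v :: s) ->
  (forall x y, E x y = [|| path_adj (v :: s) x y,
      (x == last v s) && (y == v) | (y == last v s) && (x == v)]) ->
  flexible R [set i in v :: s] [:: v] E 0 1.
Proof.
case: s => [|a [|b t]] // _ us EE; set s := b :: t in us EE *.
have va : v != a by move: us; rewrite /= inE negb_or -!andbA => /andP[].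
have al : a != last a s.
  have /andP[_ /andP[aN _]] := us.
  by apply: contraNneq aN => {1}->; rewrite /s /= mem_last.
have cX : #|[set i in [:: v, a & s]]| = (size s).+2 by rewrite card_set_uniq.
apply: (@flexible_unroot _ _ _ a).
split.
- by move=> i; rewrite !inE => /orP[]->; rewrite ?orbT.
- by rewrite /= inE eq_sym va.
- by rewrite cX /=; lia.
move=> r q _ _; rewrite cX -[size [:: a; v]]/2%N => lo hi.
have [|L [sup pat fan freeL [cr cq]]] := cycle_vectors (r := r) (s := q) us; first by lia.
exists L; split=> // i j ij.
have hub k : k != v -> (signed_form L v k != 0) = E v k.
  move=> kv; rewrite fan // EE path_adj_head // eqxx andbT (negPf kv) andbF /=.
  have [->|ka] := eqVneq k a; first by rewrite (negPf al) subr0 oner_eq0.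
  by case: (k == _); rewrite ?subrr ?eqxx // sub0r oppr_eq0 oner_eq0.
have [iv|iv] := eqVneq i v; first by rewrite iv in ij *; apply: hub; rewrite eq_sym.
have [jv|jv] := eqVneq j v.
  rewrite jv in ij *; rewrite -[signed_form L]signed_form_sym mxE hub // !EE.
  by rewrite path_adjC; congr (_ || _); rewrite orbC.
by rewrite pat // EE [in RHS]path_adj_cons (negPf iv) (negPf jv) !andbF /= !orbF.
Qed.

End Fan.

(** * Realizing a pulsar *)

Section PulsarPieces.
Variables (R : realType) (n : nat).
Implicit Types (X Y : {set 'I_n}) (W : seq 'I_n) (E : rel 'I_n) (u v w : 'I_n).
Implicit Types (F G H P C S B : sgraph 'I_n).

Local Notation flexible := (@flexible R n).

Lemma flexible_family (I : eqType) W (X : I -> {set 'I_n}) (E : I -> rel 'I_n) a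
    (l : seq I) :
  uniq W -> thin W -> uniq l -> (forall i, flexible (X i) W (E i) 0 a) ->
  (forall i j, i != j -> X i :&: X j = [set k in W]) ->
  flexible [set x | (x \in W) || has (fun i => x \in X i) l] W
    (fun x y => has (fun i => E i x y) l) 0 (a * size l).
Proof.
move=> uW thinW + flexX disjX.
elim: l => [_|i l IHl /= /andP[il ul]].
  rewrite muln0 (_ : [set _ | _] = [set k in W]); first exact: flexible_empty.
  by apply/setP=> x; rewrite !inE orbF.
have [WX _ _ _] := flexX i.
rewrite mulnS addnC.
rewrite (_ : [set x | _] =
    [set x | (x \in W) || has (fun i => x \in X i) l] :|: X i); last first.
  by apply/setP=> x; rewrite !inE orbA orbAC.
apply: (@flexible_ext _ _ _ _
    (fun x y => has (fun i => E i x y) l || E i x y)).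
  by move=> x y _; rewrite orbC.
apply: flexible_union => //; first exact: IHl.
apply/setP=> x; rewrite !inE.
have [xW|xW] /= := boolP (x \in W); first exact: WX.
apply/negP=> /andP[/hasP[j jl xj] xi].
have ji : j != i by apply: contraNneq il => <-.
by move/setP/(_ x): (disjX j i ji); rewrite !inE xj xi (negPf xW).
Qed.

Definition del v E : rel 'I_n := fun x y => [&& E x y, x != v & y != v].

Lemma path_adj_del_head v s : uniq (v :: s) ->
  del v (path_adj (v :: s)) =2 path_adj s.
Proof.
case: s => [|a s] /andP[vas _] x y; first by rewrite /del /path_adj.
rewrite /del path_adj_cons; have [->|xv] := eqVneq x v.
  by rewrite andbF; apply/esym; apply: contraNF vas => /path_adj_mem/andP[].
have [->|yv] := eqVneq y v; last by rewrite !andbT.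
by rewrite !andbF; apply/esym; apply: contraNF vas => /path_adj_mem/andP[].
Qed.

Lemma flexible_pendant v P : is_path_from v P ->
  flexible (verts P) [:: v] (edge P) 0 0.
Proof.
case/path_fromP=> a [t [us -> eP]].
by apply: flexible_ext (flexible_path R us) => i j _; rewrite eP.
Qed.

Lemma setD1_cons v s : uniq (v :: s) ->
  [set i in v :: s] :\ v = [set i in s].
Proof.
case/andP=> vs _; apply/setP=> i; rewrite !inE; case: eqP => // ->.
by apply/esym/negbTE.
Qed.

Lemma flexible_pendant_del v P : is_path_from v P -> exists2 w, edge P v w &
  flexible (verts P :\ v) [:: w] (del v (edge P)) 0 0.
Proof.
case/path_fromP=> a [t [us -> eP]]; exists a; first by rewrite eP path_adj_head.
have /andP[_ us'] := us; rewrite setD1_cons //.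
apply: flexible_ext (flexible_path R us') => i j _.
by rewrite -(path_adj_del_head us) /del eP.
Qed.

Lemma flexible_cycle_at v C : is_cycle C -> v \in verts C ->
  flexible (verts C) [:: v] (edge C) 0 1.
Proof.
by move=> cC /(cycle_rootP cC)[s [sz us -> eC]]; apply: flexible_cycle.
Qed.

Lemma flexible_cycle_del v C : is_cycle C -> v \in verts C ->
  flexible (verts C :\ v) [::] (del v (edge C)) 0 1.
Proof.
move=> cC /(cycle_rootP cC)[s [sz us -> eC]]; rewrite setD1_cons //.
case: s sz us eC => // a t _ us eC; have /andP[_ us'] := us.
apply/(@flexible_unroot _ _ _ a)/(flexible_ext _ (flexible_path R us')) => i j _.
rewrite -(path_adj_del_head us) /del eC.
by case: (i == v); case: (j == v); rewrite ?andbF ?andbT ?orbF.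
Qed.

Lemma joined_at_disjoint_del k (P : 'I_k -> sgraph 'I_n) v G i j :
  joined_at P v G -> i != j ->
  (verts (P i) :\ v) :&: (verts (P j) :\ v) = set0.
Proof.
case=> _ PP _ _ ij; apply/setP=> x; move/setP/(_ x): (PP i j ij); rewrite !inE.
by case: (x == v); rewrite // andbT /= => ->.
Qed.

Lemma has_enum (T : finType) (Q : pred T) : has Q (enum T) = [exists x, Q x].
Proof. by apply/hasP/existsP => [[x _ Qx]|[x Qx]]; exists x; rewrite ?mem_enum. Qed.

Lemma flexible_joined_at k (P : 'I_k -> sgraph 'I_n) v G a :
  joined_at P v G -> (0 < k)%N ->
  (forall i, flexible (verts (P i)) [:: v] (edge (P i)) 0 a) ->
  flexible (verts G) [:: v] (edge G) 0 (a * k).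
Proof.
move=> [vP PP vG eG] k0 flexP.
have setW : [set x in [:: v]] = [set v] by apply/setP=> x; rewrite !inE.
have := @flexible_family _ [:: v] _ _ a (enum 'I_k) isT isT (enum_uniq _) flexP.
rewrite setW size_enum_ord => /(_ PP).
rewrite (_ : [set x | _] = verts G).
  by apply: flexible_ext => x y _; rewrite eG has_enum.
apply/setP=> x; rewrite vG inE; apply/orP/bigcupP => [[]|[i _ xi]].
- by rewrite inE => /eqP->; exists (Ordinal k0).
- by case/hasP=> j _ xj; exists j.
- by right; apply/hasP; exists i; rewrite ?mem_enum.
Qed.

Lemma flexible_joined_at_del k (P : 'I_k -> sgraph 'I_n) v G a (Q : {pred 'I_k}) :
  joined_at P v G ->
  (forall i, flexible (verts (P i) :\ v) [::] (del v (edge (P i))) 0 a) ->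
  flexible [set x | [exists i in Q, x \in verts (P i) :\ v]] [::]
    (fun x y => [exists i in Q, del v (edge (P i)) x y]) 0 (a * #|Q|).
Proof.
move=> jP flexP.
have set0W : [set x in [::]] = set0 :> {set 'I_n} by apply/setP=> x; rewrite !inE.
have := @flexible_family _ [::] _ _ a (enum Q) isT isT (enum_uniq _) flexP.
rewrite set0W -cardE => /(_ (fun i j => joined_at_disjoint_del jP)).
have hasE (D : pred 'I_k) : has D (enum Q) = [exists i in Q, D i].
  by apply/hasP/exists_inP => -[j jQ Dj]; exists j; rewrite ?mem_enum // in jQ *.
rewrite (_ : [set x | _] = [set x | [exists i in Q, x \in verts (P i) :\ v]]).
  by apply: flexible_ext => x y _; rewrite hasE.
by apply/setP=> x; rewrite !inE hasE.
Qed.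

Lemma flexible_star k v S : is_generalized_star k v S ->
  flexible (verts S) [:: v] (edge S) 0 0.
Proof.
case=> k0 [P [pP jP]]; rewrite -(mul0n k).
by apply: (flexible_joined_at jP k0) => i; apply: flexible_pendant.
Qed.

(** The root w starts a pendant path that is realized, once v is deleted, with
    one vector less than it has vertices, so that a hyperbolic pair at v can use
    w; on the other pendant paths the last vector is optional. *)
Lemma flexible_star_del k v S : is_generalized_star k v S -> exists2 w, edge S v w &
  flexible (verts S :\ v) [:: w] (del v (edge S)) 0 k.-1.
Proof.
case: k => [|k] [// _ [P [pP jP]]]; have [_ PP vS eS] := jP.
have [w vw flex0] := flexible_pendant_del (pP ord0).
exists w; first by rewrite eS; apply/existsP; exists ord0.
have flexP i : flexible (verts (P i) :\ v) [::] (del v (edge (P i))) 0 1.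
  by have [wi _] := flexible_pendant_del (pP i); apply: flexible_unroot.
have := flexible_joined_at_del (predC1 ord0) jP flexP.
rewrite mul1n cardC1 card_ord -[k.+1.-1]/k => flex1.
have := flexible_union flex0 flex1 _ isT; rewrite add0n => flexU.
rewrite (_ : verts S :\ v = (verts (P ord0) :\ v) :|:
    [set x | [exists i in predC1 ord0, x \in verts (P i) :\ v]]); last first.
  apply/setP=> x; rewrite !inE vS; apply/andP/orP => [[xv /bigcupP[j _ xj]]|].
    have [j0|j0] := eqVneq j ord0; first by left; rewrite xv -j0.
    by right; apply/exists_inP; exists j; rewrite !inE ?xv.
  case=> [/andP[xv x0]|/exists_inP[j _]].
    by split=> //; apply/bigcupP; exists ord0.
  by rewrite !inE => /andP[xv xj]; split=> //; apply/bigcupP; exists j.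
apply: flexible_ext (flexU _).
  move=> x y _; rewrite /del eS; apply/orP/and3P.
    case=> [/and3P[e xv yv]|/exists_inP[j _ /and3P[e xv yv]]]; split=> //.
      by apply/existsP; exists ord0.
    by apply/existsP; exists j.
  case=> /existsP[j e] xv yv; have [j0|j0] := eqVneq j ord0.
    by left; rewrite -j0 e xv.
  by right; apply/exists_inP; exists j; rewrite ?inE // e xv.
apply/setP=> x; rewrite [RHS]inE in_nil; apply/negP.
rewrite inE => /andP[x0]; rewrite inE => /exists_inP[j j0 xj].
by move/setP/(_ x): (joined_at_disjoint_del jP j0); rewrite inE xj x0 inE.
Qed.

Lemma flexible_bouquet k v B : is_bouquet k v B ->
  flexible (verts B) [:: v] (edge B) 0 k.
Proof.
case=> k0 [C [cC jC]]; have [vC _ _ _] := jC; rewrite -(mul1n k).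
by apply: (flexible_joined_at jC k0) => i; apply: flexible_cycle_at.
Qed.

Lemma flexible_bouquet_del k v B : is_bouquet k v B ->
  flexible (verts B :\ v) [::] (del v (edge B)) 0 k.
Proof.
case=> k0 [C [cC jC]]; have [vC _ vB eB] := jC.
have := flexible_joined_at_del predT jC (fun i => flexible_cycle_del (cC i) (vC i)).
rewrite mul1n card_ord (_ : [set x | _] = verts B :\ v).
  apply: flexible_ext => x y _; rewrite /del eB.
  apply/exists_inP/and3P => [[j _ /and3P[e xv yv]]|[/existsP[j e] xv yv]].
    by split=> //; apply/existsP; exists j.
  by exists j; rewrite ?e ?xv.
apply/setP=> x; rewrite !inE vB.
apply/exists_inP/andP => [[j _]|[xv /bigcupP[j _ xj]]].
  by rewrite !inE => /andP[xv xj]; split=> //; apply/bigcupP; exists j.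
by exists j; rewrite ?inE ?xv.
Qed.

Lemma flexible_supernova al be v F : is_supernova al be v F ->
  flexible (verts F) [:: v] (edge F) 0 al.
Proof.
case=> S [B [/flexible_star flexS /flexible_bouquet flexB [SB -> eF]]].
have := flexible_union flexS flexB _ isT; rewrite add0n => flexF.
apply: flexible_ext (flexF _); first by move=> x y _; rewrite eF.
by rewrite SB; apply/setP=> x; rewrite !inE.
Qed.

Lemma flexible_supernova_del al be v F : is_supernova al be v F ->
  exists2 w, edge F v w &
  flexible (verts F :\ v) [:: w] (del v (edge F)) 0 (be.-1 + al).
Proof.
case=> S [B [/flexible_star_del[w vw flexS] /flexible_bouquet_del flexB [SB vF eF]]].
exists w; first by rewrite eF vw.
rewrite vF setDUl; apply: flexible_ext (flexible_union flexS flexB _ isT).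
  by move=> x y _; rewrite /del eF andb_orl.
apply/setP=> x; move/setP/(_ x): SB; rewrite !inE.
by case: (x == v); case: (x \in verts S); case: (x \in verts B).
Qed.

Lemma succ_in_rcons (s : seq 'I_n) u x y : y != u ->
  succ_in (rcons s u) x y = succ_in s x y.
Proof.
move=> /negPf yu; elim: s => [|a [|b s] IHs] //=; first by rewrite yu andbF.
by move: IHs => /= ->.
Qed.

Lemma path_adj_rcons (s : seq 'I_n) u x y : x != u -> y != u ->
  path_adj (rcons s u) x y = path_adj s x y.
Proof. by move=> xu yu; rewrite /path_adj !succ_in_rcons. Qed.

(** Without both centers the connecting cycle is two disjoint paths. *)
Lemma flexible_connecting_cycle al1 be1 al2 be2 F C H v u G :
  pulsar_parts al1 be1 al2 be2 F C H v u G ->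
  flexible (verts C :\ v :\ u) [::] (del u (del v (edge C))) 0 2.
Proof.
move=> /pulsar_cycle[a [s [b [t [us vC eC]]]]].
have := us; rewrite -[[:: v, a & _]]/(v :: (a :: s) ++ u :: rcons t b).
rewrite cons_uniq cat_uniq mem_cat negb_or => /andP[/andP[vas vutb]].
case/and3P=> [uas /hasPn disj /andP[utb ub]].
have {}disj x : x \in a :: s -> x \in u :: rcons t b -> False.
  by move=> xas /disj; rewrite /= xas.
have flex1 : flexible [set x in a :: s] [::] (path_adj (a :: s)) 0 1.
  exact/flexible_unroot/(flexible_path R uas).
have flex2 : flexible [set x in rcons t b] [::] (path_adj (rcons t b)) 0 1.
  case E : (rcons t b) ub => [|d r] ub; first by case: (t) E.
  exact/flexible_unroot/(flexible_path R ub).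
have vCE : verts C =i v :: (a :: s) ++ u :: rcons t b by move=> x; rewrite vC inE.
have notuv z : z \in a :: s \/ z \in rcons t b -> (z != u) && (z != v).
  case=> zs; apply/andP; split.
  - by apply/eqP => zu; apply: (disj z) => //; rewrite zu mem_head.
  - by apply: contraNneq vas => <-.
  - by apply: contraNneq utb => <-.
  - by apply: contraNneq vutb => <-; rewrite in_cons zs orbT.
have usv : uniq (v :: rcons (a :: s) u).
  rewrite cons_uniq mem_rcons in_cons negb_or vas rcons_uniq uas !andbT eq_sym.
  apply/andP; split; first by apply: contraNneq vutb => <-; rewrite mem_head.
  by apply/negP => us'; apply: (disj u) => //; rewrite mem_head.
have uutb : uniq (u :: rcons t b) by apply/andP.
have adjE x y : x != v -> y != v -> x != u -> y != u ->
    edge C x y = path_adj (a :: s) x y || path_adj (rcons t b) x y.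
  move=> xv yv xu yu; rewrite eC (negPf xv) (negPf yv) !andbF !orbF.
  have -> : path_adj [:: v, a & s ++ u :: rcons t b] x y =
      path_adj (v :: rcons (a :: s) u) x y || path_adj (u :: rcons t b) x y.
    exact: (path_adj_cat [:: v, a & s]).
  rewrite -(path_adj_rcons (a :: s) xu yu) -(path_adj_del_head usv).
  by rewrite -(path_adj_del_head uutb) /del xv yv xu yu !andbT.
rewrite (_ : verts C :\ v :\ u = [set x in a :: s] :|: [set x in rcons t b]).
  apply: flexible_ext (flexible_union flex1 flex2 _ isT).
    move=> x y _; apply/orP/and3P.
      move=> adj; have [xs ys] : (x \in a :: s \/ x \in rcons t b) /\
          (y \in a :: s \/ y \in rcons t b).
        by case: adj => /path_adj_mem/andP[-> ->]; split; auto.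
      have /andP[xu xv] := notuv _ xs; have /andP[yu yv] := notuv _ ys.
      by split=> //; apply/and3P; split=> //; rewrite adjE //; apply/orP.
    by case=> /and3P[+ xv yv] xu yu; rewrite adjE // => /orP.
  apply/setP=> x; rewrite [RHS]inE in_nil; apply/negP.
  rewrite inE => /andP[]; rewrite !(in_set, inE) => xas xtb.
  by apply: (disj x); rewrite ?in_cons ?xtb ?orbT.
apply/setP=> x; rewrite in_setU in_setD1 in_setD1 vCE in_cons mem_cat.
rewrite [x \in u :: _]in_cons !in_set.
apply/idP/orP; first by case/and3P=> /negPf-> /negPf-> /orP[//|/orP[]]; [left|rewrite orFb; right].
move=> xs; have /andP[-> ->] := notuv x xs.
by case: xs => ->; rewrite ?orbT.
Qed.

End PulsarPieces.

Section PulsarFlexibility.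
Variables (R : realType) (n : nat) (G F C H : sgraph 'I_n).
Variables (al1 be1 al2 be2 : nat) (v u : 'I_n).
Hypothesis pG : pulsar_parts al1 be1 al2 be2 F C H v u G.

Local Notation flexible := (@flexible R n).

Lemma supernova_pendant al be (w : 'I_n) S : is_supernova al be w S -> (0 < be)%N.
Proof. by case=> [? [? [[]]]]. Qed.

Lemma set_seq1 (x : 'I_n) : [set y in [:: x]] = [set x].
Proof. by apply/setP=> y; rewrite !inE. Qed.

Lemma set_seq0 : [set y in [::]] = set0 :> {set 'I_n}.
Proof. by apply/setP=> y; rewrite !inE. Qed.

Let cC : is_cycle C. Proof. by case: pG => [[]]. Qed.
Let sF : is_supernova al1 be1 v F. Proof. by case: pG => [[]]. Qed.
Let sH : is_supernova al2 be2 u H. Proof. by case: pG => [[]]. Qed.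
Let FC : verts F :&: verts C = [set v]. Proof. by case: pG => [_ []]. Qed.
Let HC : verts H :&: verts C = [set u]. Proof. by case: pG => [_ []]. Qed.
Let FH : verts F :&: verts H = set0.
Proof. by apply/eqP; rewrite setI_eq0; case: pG => [_ []]. Qed.
Let vG : verts G = verts F :|: verts C :|: verts H. Proof. by case: pG => [_ []]. Qed.
Let eG x y : edge G x y = [|| edge F x y, edge C x y | edge H x y].
Proof. by case: pG => [_ []]. Qed.

Let vFC : (v \in verts F) && (v \in verts C). Proof. by rewrite -in_setI FC set11. Qed.
Let uHC : (u \in verts H) && (u \in verts C). Proof. by rewrite -in_setI HC set11. Qed.
Let vF : v \in verts F. Proof. by case/andP: vFC. Qed.
Let vC : v \in verts C. Proof. by case/andP: vFC. Qed.
Let uH : u \in verts H. Proof. by case/andP: uHC. Qed.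

Let notFH x : x \in verts F -> x \in verts H -> False.
Proof. by move=> xF xH; move/setP/(_ x): FH; rewrite inE xF xH inE. Qed.

(** Seen from v, the first supernova and the connecting cycle share v, and the
    second supernova hangs at u; e_v is one more optional vector. *)
Lemma pulsar_flexible0 : flexible (verts G) [::] (edge G) 0 (al1 + al2 + 2).
Proof.
have flexFC := flexible_union (flexible_supernova R sF) (flexible_cycle_at R cC vC).
rewrite set_seq1 in flexFC; have {}flexFC := flexFC FC isT.
have flexG := flexible_union flexFC (flexible_supernova R sH).
rewrite set_seq1 in flexG; rewrite vG.
have -> : (al1 + al2 + 2)%N = (al1 + 1 + al2).+1 by lia.
apply: (@flexible_unroot _ _ _ v); apply: flexible_ext (flexG _ isT).
  by move=> x y _; rewrite eG orbA.
by rewrite setIUl FH set0U setIC.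
Qed.

Let vNCH : (verts C :\ v) :&: verts H = [set u].
Proof.
rewrite -HC; apply/setP=> x; rewrite !inE; have [->|_] := eqVneq x v.
  by apply/esym/negbTE/negP => /andP[vH _]; apply: (notFH vF vH).
by rewrite andbC.
Qed.

Let FDisjoint : (verts F :\ v) :&: ((verts C :\ v) :|: verts H) = set0.
Proof.
apply/setP=> x; rewrite !inE; apply/negP=> /andP[/andP[xv xF]].
rewrite xv => /orP[xC|]; last exact: notFH.
by rewrite (shared_vertex FC xF xC) eqxx in xv.
Qed.

(** Here the row of v comes from a hyperbolic pair: G - v is the disjoint union
    of the first supernova without its center and of the rest of the pulsar. *)
Lemma pulsar_attach k a : flexible ((verts C :\ v) :|: verts H) [::]
    (fun x y => del v (edge C) x y || edge H x y) k a ->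
  flexible (verts G) [::] (edge G) k.+1 (be1.-1 + al1 + a).
Proof.
move=> flexD; have [w vw flexF] := flexible_supernova_del R sF.
have := flexible_union flexF flexD; rewrite set_seq0 => /(_ FDisjoint isT) flexU.
have -> : verts G = v |: ((verts F :\ v) :|: ((verts C :\ v) :|: verts H)).
  apply/setP=> x; rewrite vG !inE.
  by have [->|xv] := eqVneq x v; rewrite ?vF //= -orbA.
have vNH : v \notin verts H by apply/negP=> vH; apply: (notFH vF vH).
apply: (flexible_hyperbolic flexU).
- by rewrite !inE eqxx.
- exact: edge_sym.
- by rewrite eG vw.
- move=> j vj; have jv : j != v by apply: contraTneq vj => ->; rewrite edge_irr.
  move: vj; rewrite eG !inE jv /= => /or3P[] /edge_mem/andP[_ ->] //.
    by rewrite orbT.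
  by rewrite !orbT.
- by move=> x y xv yv; rewrite eG /del xv yv !andbT.
Qed.

(** The rest of the pulsar is the path left from the connecting cycle, with the
    second supernova attached at u. *)
Lemma pulsar_flexible1 : flexible (verts G) [::] (edge G) 1 (al1 + al2 + be1).
Proof.
have := flexible_union (flexible_cycle_del R cC vC) (flexible_supernova R sH).
rewrite set_seq1 => /(_ vNCH isT)/pulsar_attach.
have be1_gt0 := supernova_pendant sF.
by have -> : (be1.-1 + al1 + (1 + al2) = al1 + al2 + be1)%N by lia.
Qed.

(** A hyperbolic pair is used at u inside the rest of the pulsar, before the one
    at v; what remains of the connecting cycle is two paths. *)
Lemma pulsar_flexible2 :
  flexible (verts G) [::] (edge G) 2 (al1 + al2 + be1 + be2).
Proof.
have [w uw flexH] := flexible_supernova_del R sH.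
have flexC := flexible_connecting_cycle R pG.
have be1_gt0 := supernova_pendant sF; have be2_gt0 := supernova_pendant sH.
have -> : (al1 + al2 + be1 + be2 = be1.-1 + al1 + (be2.-1 + al2 + 2))%N by lia.
have := flexible_union flexH flexC; rewrite set_seq0 => flexU.
apply: pulsar_attach.
have -> : (verts C :\ v) :|: verts H =
    u |: ((verts H :\ u) :|: (verts C :\ v :\ u)).
  apply/setP=> x; rewrite !inE.
  by have [->|xu] := eqVneq x u; rewrite ?uH ?orbT //= orbC.
apply: (flexible_hyperbolic (flexU _ isT)).
- apply/setP=> x; rewrite !inE; apply/negP=> /andP[/andP[xu xH] /and3P[_ _ xC]].
  by rewrite (shared_vertex HC xH xC) eqxx in xu.
- by rewrite !inE eqxx.
- by move=> x y; rewrite /del !(edge_sym _ y) andbCA andbC andbA andbC andbA.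
- by rewrite uw orbT.
- move=> j /orP[/and3P[uj _ jv]|uj]; rewrite !inE.
    have ju : j != u by apply: contraTneq uj => ->; rewrite edge_irr.
    by case/edge_mem/andP: uj => _ ->; rewrite ju jv orbT.
  have ju : j != u by apply: contraTneq uj => ->; rewrite edge_irr.
  by case/edge_mem/andP: uj => _ ->; rewrite ju.
- by move=> x y xu yu; rewrite /del xu yu !andbT orbC.
Qed.

End PulsarFlexibility.

Local Open Scope classical_set_scope.

Lemma flexible_inertia (R : realType) n (G : sgraph 'I_n) k a (r s : nat) :
  verts G = [set: 'I_n]%SET -> flexible R (verts G) [::] (edge G) k a ->
  (k <= r)%N -> (k <= s)%N -> (n <= r + s + a)%N -> (r + s <= n)%N ->
  inertia_set R G (r%:Z, s%:Z).
Proof.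
move=> vG [_ _ _ real] kr ks lo hi.
have [||L [_ pat freeL <- <-]] := real r s kr ks; rewrite ?vG ?cardsT ?card_ord ?addn0 //.
have [posE negE] := inertia_signed_form freeL.
by exists (signed_form L); [split=> //; apply: signed_form_sym|rewrite posE negE].
Qed.

Theorem theorem5p1 (R : realType) (n : nat) (G : sgraph 'I_n)
    (alpha1 beta1 alpha2 beta2 : nat)
    (G_verts : verts G = [set: 'I_n]%SET)
    (G_pulsar : is_pulsar alpha1 beta1 alpha2 beta2 G) :
  inertia_set R G =
    trapezoid 0 (n%:Z - alpha1%:Z - alpha2%:Z - 2) n%:Z
    `|` trapezoid 1 (n%:Z - alpha1%:Z - alpha2%:Z - beta1%:Z) n%:Z
    `|` trapezoid 1 (n%:Z - alpha1%:Z - alpha2%:Z - beta2%:Z) n%:Z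
    `|` trapezoid 2 (n%:Z - alpha1%:Z - alpha2%:Z - beta1%:Z - beta2%:Z) n%:Z.
Proof.
have [F [C [H [v [u pG]]]]] := is_pulsar_parts G_pulsar.
apply/seteqP; split=> [_ [A [symA patA] <-]|[x y]].
  have rk := inertia_rank symA; have := rank_leq_row A; rewrite -rk.
  set p := pos_inertia A; set m := neg_inertia A => pm_le.
  have := pulsar_inertia_bound patA symA G_verts pG; rewrite -/p -/m.
  case=> [bnd|[p0 m0 bnd]|[p0 m0 bnd]|[p1 m1 bnd]].
  - by left; left; left; split=> /=; lia.
  - by left; left; right; split=> /=; lia.
  - by left; right; split=> /=; lia.
  - by right; split=> /=; lia.
have flex0 := pulsar_flexible0 R pG.
have flex1 := pulsar_flexible1 R pG.
have flex1' := pulsar_flexible1 R (pulsar_parts_sym pG).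
have flex2 := pulsar_flexible2 R pG.
have nat_coord : 0 <= x -> 0 <= y -> x = `|x|%N%:Z /\ y = `|y|%N%:Z by lia.
case=> [[[|]|]|] [/= kx ky /andP[lo hi]];
  (have [||-> ->] := nat_coord; [lia|lia|]).
- by apply: (flexible_inertia G_verts flex0); lia.
- by apply: (flexible_inertia G_verts flex1); lia.
- by apply: (flexible_inertia G_verts flex1'); lia.
- by apply: (flexible_inertia G_verts flex2); lia.
Qed.
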